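(* Let $G$ and $H$ be pro-Lie groups and let $f\colon G\to H$ be a quotient morphism of topological groups. Then every one-parameter subgroup $X\colon \mathbb{R}\to H$ of $H$ lifts to one of $G$, i.e., there exists a one-parameter subgroup $Y\colon\mathbb{R}\to G$ such that $X=f\circ Y$.
   Context: ''Lie group'' means finite-dimensional real Lie group, regarded as a (Hausdorff) topological group; Lie groups are not assumed connected or second countable, so discrete groups of arbitrary cardinality are (zero-dimensional) Lie groups. For a Hausdorff topological group $G$, let $\mathcal{N}(G)$ be the set of all closed normal subgroups $N$ of $G$ such that $G/N$ (with the quotient topology) is a Lie group. $G$ is called a pro-Lie group if $G$ is complete (every Cauchy net with respect to the left uniform structure converges) and $\mathcal{N}(G)$ is a filter basis which converges to $1$; that is, for all $M,N\in\mathcal{N}(G)$ there is $P\in\mathcal{N}(G)$ with $P\subseteq M\cap N$, and every neighbourhood of $1$ in $G$ contains some $N\in\mathcal{N}(G)$. A quotient morphism of topological groups is a surjective, continuous, open group homomorphism. A one-parameter subgroup of a topological group $G$ is a continuous homomorphism $(\mathbb{R},+)\to G$. *)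

(* Defs.v *)
From HB Require Import structures.
From mathcomp Require Import all_boot all_order all_algebra.
From mathcomp Require Import all_classical all_reals all_analysis.

Set Implicit Arguments.
Unset Strict Implicit.
Unset Printing Implicit Defensive.

Import GRing.Theory numFieldNormedType.Exports.

Local Open Scope classical_set_scope.
Local Open Scope quotient_scope.
Local Open Scope group_scope.

HB.structure Definition PreTopologicalGroup := {G of Group G & Topological G}.

HB.mixin Record isTopologicalGroup G & PreTopologicalGroup G := {
  topmul_continuous : continuous (fun xy : G * G => xy.1 * xy.2 : G);
  topinv_continuous : continuous (fun x : G => x^-1 : G)
}.

#[short(type="topologicalGroupType")]
HB.structure Definition TopologicalGroup :=
  {G of PreTopologicalGroup G & isTopologicalGroup G}.

Record normal_subgroup (G : groupType) := NormalSubgroup {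
  nsub_set :> set G;
  nsub1 : nsub_set 1;
  nsubM : forall x y, nsub_set x -> nsub_set y -> nsub_set (x * y);
  nsubV : forall x, nsub_set x -> nsub_set x^-1;
  nsubJ : forall x y, nsub_set x -> nsub_set (x ^ y)
}.

Section QuotientGroup.
Variables (G : topologicalGroupType) (N : normal_subgroup G).

Definition coset_eq : rel G := fun x y => `[< nsub_set N (x^-1 * y) >].

Lemma coset_eq_refl : reflexive coset_eq.
Proof. by move=> x; apply/asboolP; rewrite mulVg; exact: nsub1. Qed.

Lemma coset_eq_sym : symmetric coset_eq.
Proof.
move=> x y; apply/asboolP/asboolP => /nsubV; by rewrite invgM invgK.
Qed.

Lemma coset_eq_trans : transitive coset_eq.
Proof.
move=> y x z /asboolP xy /asboolP yz; apply/asboolP.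
by have := nsubM xy yz; rewrite mulgA mulgK.
Qed.

Definition coset_equiv :=
  EquivRel coset_eq coset_eq_refl coset_eq_sym coset_eq_trans.

(* [quotient_topology] is the final topology for the projection. *)
Definition quotient_group : Type := quotient_topology {eq_quot coset_equiv}.

HB.instance Definition _ := Topological.on quotient_group.
HB.instance Definition _ := Quotient.on quotient_group.

Definition qproj (x : G) : quotient_group := \pi_quotient_group x.

Implicit Types a b c : quotient_group.

Lemma qproj_repr a : qproj (repr a) = a.
Proof. exact: reprK. Qed.

Lemma qproj_eq x y : qproj x = qproj y <-> nsub_set N (x^-1 * y).
Proof.
split=> [/(@eqquotP G coset_equiv (quotient_topology {eq_quot coset_equiv}))|xy].
  by move/asboolP.
by apply/(@eqquotP G coset_equiv {eq_quot coset_equiv})/asboolP.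
Qed.

Definition qmul a b : quotient_group := qproj (repr a * repr b).
Definition qone : quotient_group := qproj 1.
Definition qinv a : quotient_group := qproj (repr a)^-1.

Lemma qmul_proj x y : qmul (qproj x) (qproj y) = qproj (x * y).
Proof.
apply/qproj_eq.
have /qproj_eq hx := qproj_repr (qproj x).
have /qproj_eq hy := qproj_repr (qproj y).
move: hx hy; set u := repr _; set v := repr _ => hx hy.
have -> : (u * v)^-1 * (x * y) = (u^-1 * x) ^ v * (v^-1 * y).
  by rewrite conjgE invgM !mulgA mulgK.
by apply: nsubM => //; exact: nsubJ.
Qed.

Lemma qinv_proj x : qinv (qproj x) = qproj x^-1.
Proof.
apply/qproj_eq; have /qproj_eq := qproj_repr (qproj x).
set u := repr _ => /nsubV /(@nsubJ _ N _ u^-1).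
by rewrite conjgE invgM !invgK !mulgA mulgK.
Qed.

Lemma qmulA : associative qmul.
Proof.
move=> a b c; rewrite -(qproj_repr a) -(qproj_repr b) -(qproj_repr c).
by rewrite !qmul_proj mulgA.
Qed.

Lemma qmul1g : left_id qone qmul.
Proof. by move=> a; rewrite -(qproj_repr a) qmul_proj mul1g. Qed.

Lemma qmulg1 : right_id qone qmul.
Proof. by move=> a; rewrite -(qproj_repr a) qmul_proj mulg1. Qed.

Lemma qmulVg : left_inverse qone qinv qmul.
Proof. by move=> a; rewrite -(qproj_repr a) qinv_proj qmul_proj mulVg. Qed.

Lemma qmulgV : right_inverse qone qinv qmul.
Proof. by move=> a; rewrite -(qproj_repr a) qinv_proj qmul_proj mulgV. Qed.

HB.instance Definition _ :=
  isGroup.Build quotient_group qmulA qmul1g qmulg1 qmulVg qmulgV.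

Lemma qproj_continuous : continuous qproj.
Proof. exact: pi_continuous. Qed.

Lemma mulgr_continuous (y : G) : continuous (fun x : G => x * y).
Proof.
move=> x; apply: (@continuous_comp _ _ _ (fun x => (x, y))
  (fun xy : G * G => xy.1 * xy.2)); last exact: topmul_continuous.
by apply: cvg_pair => /=; [exact: cvg_id|exact: cvg_cst].
Qed.

Lemma qproj_open (U : set G) : open U -> open (qproj @` U).
Proof.
move=> oU; suff : open (qproj @^-1` (qproj @` U)) by [].
have -> : qproj @^-1` (qproj @` U) =
    \bigcup_(n in nsub_set N) ((fun x => x * n) @^-1` U).
  apply/seteqP; split=> [x [u Uu /qproj_eq uNx]|x [n Nn Uxn]] /=.
    exists (u^-1 * x)^-1; first exact: nsubV.
    by rewrite /= invgM invgK mulgA mulgV mul1g.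
  exists (x * n) => //; apply/qproj_eq.
  rewrite invgM mulgVK; exact: nsubV.
apply: bigcup_open => n _; apply: open_comp => // x _.
exact: mulgr_continuous.
Qed.

Lemma qproj_nbhs (x : G) (U : set G) : nbhs x U -> nbhs (qproj x) (qproj @` U).
Proof.
rewrite !nbhsE => -[V [oV Vx] VU]; exists (qproj @` V); last exact: image_subset.
by split; [exact: qproj_open|exists x].
Qed.

Lemma qmul_continuous :
  continuous (fun ab : quotient_group * quotient_group => ab.1 * ab.2).
Proof.
move=> [a b]; rewrite -(qproj_repr a) -(qproj_repr b).
set x := repr a; set y := repr b => W.
rewrite /= [X in nbhs X](qmul_proj x y) => nW.
have nW' : nbhs (x * y) (qproj @^-1` W) by exact: qproj_continuous.
have [[U V] /= [nU nV] UVW] := @topmul_continuous G (x, y) _ nW'.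
exists (qproj @` U, qproj @` V); first by split; exact: qproj_nbhs.
move=> [c d] [/= [u Uu <-] [v Vv <-]].
rewrite [_ * _]qmul_proj; exact: (UVW (u, v)).
Qed.

Lemma qinv_continuous : continuous (fun a : quotient_group => a^-1).
Proof.
move=> a; rewrite -(qproj_repr a); set x := repr a => W.
rewrite [X in nbhs X](qinv_proj x) => nW.
have nW' : nbhs x^-1 (qproj @^-1` W) by exact: qproj_continuous.
have nU := @topinv_continuous G x _ nW'.
apply: filterS (qproj_nbhs nU) => _ [u Wu <-].
by rewrite /= [_^-1]qinv_proj.
Qed.

HB.instance Definition _ :=
  isTopologicalGroup.Build quotient_group qmul_continuous qinv_continuous.

End QuotientGroup.

Section Smooth.
Variables (R : realType) (V W : normedModType R).

(* [A] is meant to be open and [f] matters only on [A].  When [V] is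
   finite-dimensional, this agrees with the existence and continuity of all the
   partial derivatives of order at most [k]. *)
Fixpoint Ck_on (k : nat) (A : set V) (f : V -> W) : Prop :=
  {within A, continuous f} /\
  match k with
  | 0 => True
  | k'.+1 => forall v : V,
      (forall x, A x -> derivable f x v) /\ Ck_on k' A ('D_v f)
  end.

Definition smooth_on (A : set V) (f : V -> W) := forall k, Ck_on k A f.

End Smooth.

Section LieGroup.
Variable R : realType.

(* [chart_fun] matters only on [chart_dom], and [chart_inv] only on its image. *)
Record chart (T : topologicalType) (n : nat) := Chart {
  chart_dom : set T;
  chart_fun :> T -> 'rV[R]_n;
  chart_inv : 'rV[R]_n -> T;
  chart_dom_open : open chart_dom;
  chart_im_open : open (chart_fun @` chart_dom);
  chart_continuous : {within chart_dom, continuous chart_fun};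
  chart_inv_continuous :
    {within chart_fun @` chart_dom, continuous chart_inv};
  chart_funK : forall x, chart_dom x -> chart_inv (chart_fun x) = x
}.

Definition chart_im (T : topologicalType) n (c : chart T n) : set 'rV[R]_n :=
  c @` chart_dom c.

Definition smooth_atlas (T : topologicalType) n (A : set (chart T n)) :=
  (forall x, exists2 c, A c & chart_dom c x) /\
  (forall c d, A c -> A d ->
     smooth_on (c @` (chart_dom c `&` chart_dom d)) (d \o chart_inv c)).

Definition smooth_mul (G : topologicalGroupType) n (A : set (chart G n)) :=
  forall a b c, A a -> A b -> A c ->
    smooth_on
      [set uv : 'rV[R]_n * 'rV[R]_n |
        [/\ chart_im a uv.1, chart_im b uv.2
          & chart_dom c (chart_inv a uv.1 * chart_inv b uv.2)]]
      (fun uv => c (chart_inv a uv.1 * chart_inv b uv.2)).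

Definition smooth_inv (G : topologicalGroupType) n (A : set (chart G n)) :=
  forall a c, A a -> A c ->
    smooth_on
      [set u : 'rV[R]_n | chart_im a u /\ chart_dom c (chart_inv a u)^-1]
      (fun u => c (chart_inv a u)^-1).

(* "Smooth" is C^oo.  A single dimension [n] suffices, as topological groups are homogeneous. *)
Definition is_lie_group (G : topologicalGroupType) :=
  hausdorff_space G /\
  exists (n : nat) (A : set (chart G n)),
    [/\ smooth_atlas A, smooth_mul A & smooth_inv A].

End LieGroup.

Section ProLie.
Variables (R : realType) (G : topologicalGroupType).

Definition left_entourage : set_system (G * G) :=
  [set E | exists2 U, nbhs (1 : G) U &
     [set xy | U (xy.1^-1 * xy.2)] `<=` E].

Definition directed (I : Type) (le : I -> I -> Prop) :=
  [/\ inhabited I, forall i, le i i,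
      forall i j k, le i j -> le j k -> le i k
    & forall i j, exists k, le i k /\ le j k].

Definition cauchy_net (I : Type) (le : I -> I -> Prop) (x : I -> G) :=
  forall E, left_entourage E ->
    exists i0, forall i j, le i0 i -> le i0 j -> E (x i, x j).

Definition net_converges (I : Type) (le : I -> I -> Prop) (x : I -> G) (l : G) :=
  forall U, nbhs l U -> exists i0, forall i, le i0 i -> U (x i).

Definition left_complete :=
  forall (I : Type) (le : I -> I -> Prop) (x : I -> G),
    directed le -> cauchy_net le x -> exists l, net_converges le x l.

Definition lie_quotient_subgroups : set (normal_subgroup G) :=
  [set N | closed (nsub_set N) /\ is_lie_group R (quotient_group N)].

Definition pro_lie :=
  [/\ hausdorff_space G,
      left_complete,
      forall M N, lie_quotient_subgroups M -> lie_quotient_subgroups N ->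
        exists2 P, lie_quotient_subgroups P &
          nsub_set P `<=` nsub_set M `&` nsub_set N
    & forall U, nbhs (1 : G) U ->
        exists2 N, lie_quotient_subgroups N & nsub_set N `<=` U].

End ProLie.

Definition quotient_morphism (G H : topologicalGroupType) (f : G -> H) :=
  [/\ {morph f : x y / x * y}, continuous f,
      forall A : set G, open A -> open (f @` A)
    & forall y, exists x, f x = y].

Definition one_parameter_subgroup (R : realType) (G : topologicalGroupType)
    (X : R -> G) :=
  continuous X /\ forall s t : R, X (s + t)%R = X s * X t.

(* Main.v *)
Require Import Defs.
From mathcomp Require Import all_boot all_order all_algebra.
From mathcomp Require Import all_classical all_reals all_analysis.
From mathcomp Require Import zify ring lra.
Import numFieldNormedType.Exports.

(** Both the given subgroup [X] and the unknown lift are approximated in the Lie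
quotients [G/N], and the lifts found there are glued by completeness of [G].

Lie quotients.  In a chart at [1] of a Lie group [L] the multiplication satisfies
[|xy - x - y| <= C|x||y|], which gives [x^k = kx + O(k^2|x|^2)] as long as [k|x|]
is small.  Hence, if [lam_i |g_i|] is bounded and [lam_i -> oo], the powers
[g_i^floor(t lam_i)] converge along an ultrafilter to a one-parameter subgroup
whose tangent vector is the limit of [lam_i g_i].  No differential equation is
needed: this identifies one-parameter subgroups with tangent vectors, and
continuous homomorphisms act linearly on them.  For an open surjection
[h : L -> Q] let [g_i] be an almost shortest lift of [X(1/i)].  If [i|g_i|] is
bounded, the limit of [g_i^floor(ti)] lifts [X].  Otherwise [g_i] rescaled by
[1/|g_i|] yields a one-parameter subgroup [Z] of [ker h], and
[g_i Z(-|g_i|)] is a much shorter lift of [X(1/i)], a contradiction.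

Gluing.  For each [N] the lifts to [G/N] of [X] modulo the closure of [f(N)] thus
form a nonempty affine subspace of a finite-dimensional space, and the transition
maps between them are affine.  Such an inverse system has a nonempty limit (linear
compactness). *)

Set Implicit Arguments.
Unset Strict Implicit.
Unset Printing Implicit Defensive.
Import Order.TTheory GRing.Theory Num.Theory.
Local Open Scope classical_set_scope.
Local Open Scope ring_scope.

(** * Second differences of C^2 maps *)

Section MeanValue.
Variables (R : realType) (V : normedModType R).

Lemma mx_norm_le m n (x : 'M[R]_(m, n)) (K : R) :
  0 <= K -> (forall i j, `|x i j| <= K) -> `|x| <= K.
Proof.
by move=> K0 xK; rewrite [leLHS]/Num.norm/= mx_normrE (bigmax_le _ K0).
Qed.

Lemma le_mx_norm m n (x : 'M[R]_(m, n)) i j : `|x i j| <= `|x|.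
Proof.
rewrite [leRHS]/Num.norm/= mx_normrE.
exact: (@le_bigmax _ _ _ _ (fun ij : 'I_m * 'I_n => `|x ij.1 ij.2|) (i, j)).
Qed.

Lemma is_derive_line n (f : V -> 'rV[R]_n) (x e : V) k (t : R) :
  derivable f (x + t *: e) e ->
  is_derive t 1 (fun s => f (x + s *: e) 0 k) (('D_e f (x + t *: e)) 0 k).
Proof.
move=> df; rewrite derive_mx // mxE.
have /derivable_mxP/(_ 0 k) dfk := df.
have shiftE : (fun h : R => h^-1 *: (f (x + (h *: 1 + t) *: e) 0 k -
    f (x + t *: e) 0 k)) =
  (fun h : R => h^-1 *: (f (h *: e + (x + t *: e)) 0 k - f (x + t *: e) 0 k)).
  by apply/funext => h; rewrite scalerDl [_%:A]mulr1 addrCA.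
by apply: DeriveDef; rewrite /derivable /derive /= shiftE.
Qed.

(** The norm of a row is the maximum over its entries, so the scalar mean value theorem is applied
    to each entry; the intermediate point may differ between entries. *)
Lemma mean_value_norm n (f : V -> 'rV[R]_n) (x e : V) (s K : R) :
  (forall t : R, `|t| <= `|s| -> derivable f (x + t *: e) e) ->
  (forall t : R, `|t| <= `|s| -> `|'D_e f (x + t *: e)| <= K) ->
  `|f (x + s *: e) - f x| <= K * `|s|.
Proof.
move=> df Df.
have K0 : 0 <= K by apply: le_trans (Df 0 _); rewrite ?normr0.
apply: mx_norm_le => [|i k]; first exact: mulr_ge0.
rewrite (ord1 i) {i}.
pose h (t : R) : R := f (x + t *: e) 0 k.
have dh (t : R) : `|t| <= `|s| -> is_derive t 1 h (('D_e f (x + t *: e)) 0 k).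
  by move=> /df; exact: is_derive_line.
have ch (t : R) : `|t| <= `|s| -> {for t, continuous h}.
  move=> /dh ?.
  by apply: differentiable_continuous; apply/derivable1_diffP.
have cseg (a b : R) : (forall t : R, t \in `[a, b] -> `|t| <= `|s|) ->
    {within `[a, b], continuous h}.
  move=> ab; apply: continuous_in_subspaceT => t /set_mem tab.
  exact/ch/ab.
suff [c cs ->] : exists2 c, `|c| <= `|s| &
    `|(f (x + s *: e) - f x) 0 k| = `|('D_e f (x + c *: e)) 0 k * s|.
  rewrite normrM ler_wpM2r //.
  exact: le_trans (le_mx_norm _ _ _) (Df _ cs).
have hE : (f (x + s *: e) - f x) 0 k = h s - h 0.
  by rewrite /h !mxE scale0r addr0.
have [s0|s0] := leP 0 s.
  have sb (t : R) : t \in `[0, s] -> `|t| <= `|s|.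
    by rewrite in_itv/= => /andP[? ?]; rewrite !ger0_norm.
  have [||c cs hc] := @MVT_segment _ h (fun t => ('D_e f (x + t *: e)) 0 k) 0 s s0.
  - by move=> t /subset_itv_oo_cc ts; exact/dh/sb.
  - exact: cseg.
  by exists c; [exact: sb|rewrite hE hc subr0].
have sb (t : R) : t \in `[s, 0] -> `|t| <= `|s|.
  by rewrite in_itv/= => /andP[? ?]; rewrite !ler0_norm ?lerN2 // ltW.
have [||c cs hc] := @MVT_segment _ h (fun t => ('D_e f (x + t *: e)) 0 k) s 0 (ltW s0).
- by move=> t /subset_itv_oo_cc ts; exact/dh/sb.
- exact: cseg.
by exists c; [exact: sb|rewrite hE distrC hc sub0r mulrN normrN].
Qed.

Lemma derivable_shift n (f : V -> 'rV[R]_n) (x c e : V) :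
  derivable f (x + c) e -> derivable (fun y => f (y + c)) x e.
Proof.
by rewrite /derivable /=; under eq_fun do rewrite addrA.
Qed.

Lemma derive_shift n (f : V -> 'rV[R]_n) (x c e : V) :
  'D_e (fun y => f (y + c)) x = 'D_e f (x + c).
Proof.
by rewrite /derive /=; under eq_fun do rewrite -addrA.
Qed.

(** Two applications of the mean value inequality: to [y |-> f (y + t *: e') - f y] along [e], then
    to ['D_e f] along [e']. *)
Lemma second_difference_le n (f : V -> 'rV[R]_n) (x e e' : V) (s t K : R) :
  (forall a b : R, `|a| <= `|s| -> `|b| <= `|t| ->
    [/\ derivable f (x + a *: e + b *: e') e,
        derivable ('D_e f) (x + a *: e + b *: e') e'
      & `|'D_e' ('D_e f) (x + a *: e + b *: e')| <= K]) ->
  `|f (x + s *: e + t *: e') - f (x + s *: e) - (f (x + t *: e') - f x)|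
    <= K * `|s| * `|t|.
Proof.
move=> H.
pose g y := f (y + t *: e') - f y.
have dfx (a b : R) : `|a| <= `|s| -> `|b| <= `|t| -> derivable f (x + a *: e + b *: e') e.
  by move=> sa tb; have [] := H a b sa tb.
have dg (a : R) : `|a| <= `|s| -> derivable (fun y => f (y + t *: e')) (x + a *: e) e.
  by move=> sa; apply: derivable_shift; apply: dfx.
have dg0 (a : R) : `|a| <= `|s| -> derivable f (x + a *: e) e.
  by move=> sa; have := dfx a 0 sa; rewrite normr0 scale0r addr0; apply.
have := @mean_value_norm n g x e s (K * `|t|).
rewrite /g -mulrA (mulrC `|t|) mulrA; apply=> a sa; first by apply: derivableB; auto.
rewrite deriveB; [|by auto|by auto].
rewrite derive_shift.
apply: (@mean_value_norm n ('D_e f) (x + a *: e) e' t K) => b tb.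
  by have [_ + _] := H a b sa tb.
by have [_ _ +] := H a b sa tb.
Qed.

End MeanValue.

Section Coordinatewise.
Variable R : realType.

(** The coordinates of [v] are replaced by those of [u] one at a time. In the maximum norm a ball is
    a box, so all intermediate points [mix m] stay in it. *)
Lemma coordinatewise_lipschitz n (W : normedModType R) (q : 'rV[R]_n -> W)
    (r K : R) :
  0 <= K ->
  (forall x i s, `|x| < r -> `|x + s *: delta_mx 0 i| < r ->
     `|q (x + s *: delta_mx 0 i) - q x| <= K * `|s|) ->
  forall u v, `|u| < r -> `|v| < r -> `|q u - q v| <= n%:R * K * `|u - v|.
Proof.
move=> K0 qK u v ur vr.
have r0 : 0 < r by exact: le_lt_trans vr.
pose mix m := \row_(k < n) (if (k < m)%N then u 0 k else v 0 k) : 'rV[R]_n.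
have mixr m : `|mix m| < r.
  apply: (@le_lt_trans _ _ (Num.max `|u| `|v|)); last by rewrite gt_max ur vr.
  apply: mx_norm_le => [|i j]; first by rewrite le_max normr_ge0.
  rewrite (ord1 i) mxE; case: ifP => _; by rewrite le_max le_mx_norm ?orbT.
have mixS (i : 'I_n) :
    mix i.+1 = mix i + (u 0 i - v 0 i) *: delta_mx 0 i.
  apply/rowP => k; rewrite !mxE eqxx /= ltnS leq_eqVlt.
  case: (eqVneq k i) => [->|ki]; first by rewrite eqxx ltnn mulr1 subrKC.
  by rewrite (negbTE (_ : val k != val i)) //= mulr0 addr0.
have stepK (i : 'I_n) : `|q (mix i.+1) - q (mix i)| <= K * `|u - v|.
  rewrite mixS; apply: (le_trans (qK _ _ _ (mixr i) _)); first by rewrite -mixS.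
  rewrite ler_wpM2l //; apply: le_trans (le_mx_norm (u - v) 0 i).
  by rewrite !mxE.
have -> : q u - q v = q (mix n) - q (mix 0%N).
  by congr (q _ - q _); apply/rowP => k; rewrite mxE ?ltn_ord.
rewrite -(telescope_sumr (fun i => q (mix i)) (leq0n n)) big_mkord.
apply: le_trans (ler_norm_sum _ _ _) _.
apply: le_trans (ler_sum _ (fun i _ => stepK i)) _.
by rewrite sumr_const card_ord -mulrA mulr_natl.
Qed.

End Coordinatewise.

Section Mixed.
Variable R : realType.

Lemma within_cvg_nbhs (T U : topologicalType) (A : set T) (f : T -> U) (x : T) :
  nbhs x A -> {within A, continuous f} -> {for x, continuous f}.
Proof.
rewrite nbhsE => -[B [oB Bx] BA] cf.
have := continuous_subspaceW BA cf.
by rewrite continuous_open_subspace // => /(_ x); apply; rewrite inE.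
Qed.

Lemma norm_scale_delta n (s : R) (i : 'I_n) :
  `|s *: (delta_mx 0 i : 'rV[R]_n)| = `|s|.
Proof.
apply/eqP; rewrite eq_le; apply/andP; split.
  apply: mx_norm_le => // j k; rewrite !mxE normrM.
  by case: (_ && _); rewrite ?normr1 ?normr0 ?mulr1 ?mulr0.
have := le_mx_norm (s *: (delta_mx 0 i : 'rV[R]_n)) 0 i.
by rewrite !mxE !eqxx mulr1.
Qed.

(** The mixed second derivatives are bounded near [(a, b)]. This bounds second differences along two
    coordinate directions, and [coordinatewise_lipschitz], used once in each argument, extends the
    bound to arbitrary increments. *)
Lemma mixed_difference_bound m n p (F : 'rV[R]_m * 'rV[R]_n -> 'rV[R]_p)
    (W : set ('rV[R]_m * 'rV[R]_n)) (a : 'rV[R]_m) (b : 'rV[R]_n) :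
  nbhs (a, b) W -> Ck_on 2 W F ->
  exists rho C : R, [/\ 0 < rho, 0 <= C &
    forall u u' v v', `|u| < rho -> `|u'| < rho -> `|v| < rho -> `|v'| < rho ->
      `|F (a + u, b + v) - F (a + u', b + v) -
        (F (a + u, b + v') - F (a + u', b + v'))| <= C * `|u - u'| * `|v - v'|].
Proof.
move=> nW [_ C2].
pose e i : 'rV[R]_m * 'rV[R]_n := (delta_mx 0 i, 0).
pose e' j : 'rV[R]_m * 'rV[R]_n := (0, delta_mx 0 j).
pose D2 i j := 'D_(e' j) ('D_(e i) F).
(* The summand 1 leaves room for the variation of the derivatives near [(a, b)]. *)
pose K := 1 + `|\matrix_(i, j) `|D2 i j (a, b)| |.
have K0 : 0 <= K by rewrite addr_ge0.
have nK i j : \forall x \near (a, b), `|D2 i j x| <= K.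
  have cD : {for (a, b), continuous (D2 i j)}.
    apply: within_cvg_nbhs nW _.
    by have [_ [_ /(_ (e' j))[_ []]]] := C2 (e i).
  have : \forall x \near (a, b), `|D2 i j (a, b) - D2 i j x| < 1.
    by move/cvgrPdist_lt : cD; apply.
  apply: filterS => x; rewrite distrC => Dx.
  rewrite -[D2 i j x](subrK (D2 i j (a, b))).
  apply: le_trans (ler_normD _ _) _; rewrite lerD //; first exact: ltW.
  have := le_mx_norm (\matrix_(i, j) `|D2 i j (a, b)|) i j.
  by rewrite mxE normr_id.
have : \forall x \near (a, b), W x /\ forall ij, `|D2 ij.1 ij.2 x| <= K.
  apply: filterI => //.
  apply: (@filter_forall _ ('I_m * 'I_n)%type (fun ij x => `|D2 ij.1 ij.2 x| <= K) _
    (nbhs_filter (a, b))) => -[i j]; exact: nK.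
move=> /nbhs_ballP[r /= r0 rW].
have rW' u v : `|u| < r -> `|v| < r -> W (a + u, b + v) /\
    forall i j, `|D2 i j (a + u, b + v)| <= K.
  move=> ur vr; have [|Wuv DK] := rW (a + u, b + v).
    by split; rewrite /= -ball_normE /= opprD addrA subrr sub0r normrN.
  by split=> // i j; exact: (DK (i, j)).
have r30 : 0 < r / 3 by lra.
have r3r : r / 3 < r by lra.
(* If [x] and [x + s *: delta_mx 0 i] have norm below [r / 3], then [|s| < 2 * r / 3], so all
   [x + t *: delta_mx 0 i] with [|t| <= |s|] have norm below [r]. *)
exists (r / 3), (m%:R * (n%:R * K)); split=> //; first by rewrite !mulr_ge0.
have small k (x : 'rV[R]_k) i (s t : R) : `|x| < r / 3 ->
    `|x + s *: delta_mx 0 i| < r / 3 -> `|t| <= `|s| ->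
    `|x + t *: delta_mx 0 i| < r.
  move=> xr xsr ts; apply: le_lt_trans (ler_normD _ _) _.
  rewrite norm_scale_delta.
  have : `|s| <= `|x + s *: delta_mx 0 i| + `|x|.
    rewrite -(norm_scale_delta s i) -[X in `|X| <= _](addKr x) addrC.
    exact: ler_normB.
  by lra.
move=> u u' v v' ur ur' vr vr'.
rewrite -!mulrA.
have -> : m%:R * (n%:R * (K * (`|u - u'| * `|v - v'|))) =
  m%:R * (n%:R * K * `|v - v'|) * `|u - u'| by ring.
set d1 := (X in `|X|).
have -> : d1 = (F (a + u, b + v) - F (a + u, b + v')) -
               (F (a + u', b + v) - F (a + u', b + v')).
  by rewrite /d1; apply/rowP => k; rewrite !mxE; ring.
apply: (@coordinatewise_lipschitz _ _ _
  (fun u => F (a + u, b + v) - F (a + u, b + v')) (r / 3)) => //.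
  by rewrite !mulr_ge0.
move=> {u u' ur ur' d1} u i s ur usr /=.
set d1 := (X in `|X|).
have -> : d1 = (F (a + (u + s *: delta_mx 0 i), b + v) - F (a + u, b + v)) -
   (F (a + (u + s *: delta_mx 0 i), b + v') - F (a + u, b + v')).
  by rewrite /d1; apply/rowP => k; rewrite !mxE; ring.
have -> : n%:R * K * `|v - v'| * `|s| = n%:R * (K * `|s|) * `|v - v'| by ring.
apply: (@coordinatewise_lipschitz _ _ _
  (fun v => F (a + (u + s *: delta_mx 0 i), b + v) - F (a + u, b + v)) (r / 3))
  => //; first by rewrite mulr_ge0.
move=> {v v' vr vr' d1} v j t vr vtr /=.
have shE (al be : R) : (a + u, b + v) + al *: e i + be *: e' j =
    (a + (u + al *: delta_mx 0 i), b + (v + be *: delta_mx 0 j)).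
  by rewrite /e /e'; congr pair; rewrite /= scaler0 ?addr0 addrA.
have := @second_difference_le R _ p F (a + u, b + v) (e i) (e' j) s t K.
have := shE s t; have := shE s 0; have := shE 0 t; rewrite !scale0r !addr0.
move=> -> -> ->.
set A1 := F _; set A2 := F _; set A3 := F _; set A4 := F _ => H.
have -> : A1 - A3 - (A2 - A4) = A1 - A2 - (A3 - A4).
  by apply/rowP => k; rewrite !mxE; ring.
apply: H => al be als bet; rewrite shE.
have [Wx DK] := rW' _ _ (small _ _ _ _ _ ur usr als) (small _ _ _ _ _ vr vtr bet).
have [dF [_ dDF]] := C2 (e i).
by split; [exact: dF|exact: (dDF (e' j)).1|exact: DK].
Qed.

End Mixed.

(** * Local charts of Lie groups *)

Section LocalChart.
Variable R : realType.

(* A chart translated so as to map [1] to [0].  The estimates hold only on the part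
   of [lc_dom] that is mapped into the ball of radius [lc_rad]. *)
Record local_chart (L : topologicalGroupType) (n : nat) := LocalChart {
  lc_dom : set L;
  lc_fun :> L -> 'rV[R]_n;
  lc_inv : 'rV[R]_n -> L;
  lc_rad : R;
  lc_const : R;
  lc_rad_gt0 : 0 < lc_rad;
  lc_const_gt0 : 0 < lc_const;
  lc_dom1 : lc_dom 1%g;
  lc_fun1 : lc_fun 1%g = 0;
  lc_dom_open : open lc_dom;
  lc_continuous : forall x, lc_dom x -> {for x, continuous lc_fun};
  lc_inv_dom : forall u, `|u| < lc_rad -> lc_dom (lc_inv u);
  lc_invK : forall u, `|u| < lc_rad -> lc_fun (lc_inv u) = u;
  lc_inv_continuous : forall u, `|u| < lc_rad -> {for u, continuous lc_inv};
  lc_funK : forall x, lc_dom x -> lc_inv (lc_fun x) = x;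
  lc_domM : forall x y, lc_dom x -> lc_dom y ->
    `|lc_fun x| < lc_rad -> `|lc_fun y| < lc_rad -> lc_dom (x * y)%g;
  lc_difference : forall x x' y y',
    lc_dom x -> lc_dom x' -> lc_dom y -> lc_dom y' ->
    `|lc_fun x| < lc_rad -> `|lc_fun x'| < lc_rad ->
    `|lc_fun y| < lc_rad -> `|lc_fun y'| < lc_rad ->
    `|lc_fun (x * y)%g - lc_fun (x' * y)%g -
      (lc_fun (x * y')%g - lc_fun (x' * y')%g)|
    <= lc_const * `|lc_fun x - lc_fun x'| * `|lc_fun y - lc_fun y'|
}.

(** [lc_difference] is the second difference bound for the multiplication read in a chart [c] at 1,
    and [lc_domM] holds because products of points near 1 stay in the domain of [c]. *)
Lemma lie_group_local_chart (L : topologicalGroupType) :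
  is_lie_group R L -> exists n, inhabited (local_chart L n).
Proof.
move=> [_ [n [A [[cover _] smM _]]]]; exists n.
have [c Ac c1] := cover 1%g.
pose a := c 1%g; pose ic := chart_inv c.
have ima : chart_im c a by exists 1%g.
have nim : nbhs a (chart_im c) by apply: open_nbhs_nbhs; split=> //; exact: chart_im_open.
have cic u : chart_im c u -> {for u, continuous ic}.
  move=> cu; apply: within_cvg_nbhs (@chart_inv_continuous _ _ _ c).
  by apply: open_nbhs_nbhs; split=> //; exact: chart_im_open.
have cc x : chart_dom c x -> {for x, continuous c}.
  move=> cx; apply: within_cvg_nbhs (@chart_continuous _ _ _ c).
  by apply: open_nbhs_nbhs; split=> //; exact: chart_dom_open.
have icc x : chart_dom c x -> ic (c x) = x by exact: chart_funK.
have icd u : chart_im c u -> chart_dom c (ic u) by move=> [x cx <-]; rewrite icc.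
have icK u : chart_im c u -> c (ic u) = u by move=> [x cx <-]; rewrite icc.
have ic1 : ic a = 1%g by exact: icc.
have cica : ic @ a --> (1%g : L) by rewrite -ic1; exact: cic.
pose F (uv : 'rV[R]_n * 'rV[R]_n) := c (ic uv.1 * ic uv.2)%g.
pose W := [set uv : 'rV[R]_n * 'rV[R]_n |
  [/\ chart_im c uv.1, chart_im c uv.2 & chart_dom c (ic uv.1 * ic uv.2)%g]].
have nW : nbhs (a, a) W.
  have mulc : (fun uv : 'rV[R]_n * 'rV[R]_n => (ic uv.1 * ic uv.2)%g) @ (a, a) -->
      (1%g : L).
    have := @topmul_continuous L (1, 1)%g; rewrite /continuous_at /= mulg1 => mc.
    apply: (@cvg_comp _ _ _ (fun uv : 'rV[R]_n * 'rV[R]_n => (ic uv.1, ic uv.2))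
      (fun xy : L * L => (xy.1 * xy.2)%g) _ (nbhs ((1, 1)%g : L * L)) _ _ mc).
    apply: cvg_pair => /=.
      apply: (@cvg_comp _ _ _ fst ic _ (nbhs a)); first exact: cvg_fst.
      exact: cica.
    apply: (@cvg_comp _ _ _ snd ic _ (nbhs a)); first exact: cvg_snd.
    exact: cica.
  have n3 : nbhs (a, a) [set uv : 'rV[R]_n * 'rV[R]_n | chart_dom c (ic uv.1 * ic uv.2)%g].
    by apply: mulc; apply: open_nbhs_nbhs; split=> //; exact: chart_dom_open.
  have n1 : nbhs (a, a) [set uv : 'rV[R]_n * 'rV[R]_n | chart_im c uv.1].
    exact: (@cvg_fst _ _ (nbhs a) (nbhs a)).
  have n2 : nbhs (a, a) [set uv : 'rV[R]_n * 'rV[R]_n | chart_im c uv.2].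
    exact: (@cvg_snd _ _ (nbhs a) (nbhs a)).
  by apply: filterS (filterI n1 (filterI n2 n3)) => uv [? [? ?]].
have [rho [C [rho0 C0 FC]]] := mixed_difference_bound nW (smM c c c Ac Ac Ac 2%N).
have /nbhs_ballP[s /= s0 sW] := nW.
pose r := Num.min rho s.
have rW u v : `|u| < r -> `|v| < r -> W (a + u, a + v).
  rewrite !lt_min => /andP[_ us] /andP[_ vs]; apply: sW.
  by split; rewrite /= -ball_normE /= opprD addrA subrr sub0r normrN.
(* The chart is translated by [a], the image of 1; the constant is [C + 1] since [C] may vanish. *)
constructor; exists (chart_dom c) (fun x => c x - a) (fun u => ic (a + u)) r (C + 1).
- by rewrite lt_min rho0.
- by rewrite ltr_wpDl.
- exact: c1.
- by rewrite subrr.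
- exact: chart_dom_open.
- move=> x cx; apply: (@continuousB _ _ _ c (fun=> a)); [exact: cc|exact: cst_continuous].
- by move=> u ur; have [? _ _] := rW _ _ ur ur; exact: icd.
- by move=> u ur; have [? _ _] := rW _ _ ur ur; rewrite icK// addrC addKr.
- move=> u ur; have [imu _ _] := rW _ _ ur ur.
  apply: (@cvg_comp _ _ _ (fun u => a + u) ic _ (nbhs (a + u))); last exact: cic.
  apply: (@continuousD _ _ _ (fun=> a) id); [exact: cst_continuous|exact: cvg_id].
- by move=> x cx; rewrite subrKC; exact: icc.
- move=> x y cx cy xr yr; have [_ _] := rW _ _ xr yr.
  by rewrite /= !subrKC !icc.
- move=> x x' y y' cx cx' cy cy'.
  rewrite !lt_min => /andP[xr _] /andP[x'r _] /andP[yr _] /andP[y'r _].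
  have := FC _ _ _ _ xr x'r yr y'r.
  rewrite /F /= !subrKC. rewrite !chart_funK//.
  have dB (u v : 'rV[R]_n) : u - a - (v - a) = u - v by rewrite opprB addrA subrK.
  rewrite !dB => /le_trans; apply.
  by rewrite !mulrDl lerDl !mulr_ge0.
Qed.

End LocalChart.

(** * Powers in a local chart *)

Section Powers.
Variables (R : realType) (L : topologicalGroupType) (n : nat).
Variable c : local_chart R L n.
Implicit Types (x y : L) (j k : nat).

Local Notation C := (lc_const c).
Local Notation r := (lc_rad c).
Local Notation dom := (lc_dom c).

(* [2 * eps <= r] keeps the powers inside the ball, and [2 * C * eps <= 1] absorbs
   the quadratic errors. *)
Definition lc_eps : R := Num.min (r / 2) (1 / (2 * C)).

Lemma lc_eps_gt0 : 0 < lc_eps.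
Proof.
have r0 := lc_rad_gt0 c; have C0 := lc_const_gt0 c; have C0' := ltW C0.
by rewrite lt_min !divr_gt0// mulr_gt0.
Qed.

Lemma lc_eps_rad : 2 * lc_eps <= r.
Proof. by rewrite -ler_pdivlMl// mulrC /lc_eps ge_min lexx. Qed.

Lemma lc_eps_const : 2 * C * lc_eps <= 1.
Proof.
have C0 := lc_const_gt0 c; have C0' := ltW C0.
by rewrite -ler_pdivlMl ?mulr_gt0// mulr1 -div1r /lc_eps ge_min lexx orbT.
Qed.

Lemma lt_eps_rad (a : R) : a < lc_eps -> a < r.
Proof. by have := lc_eps_rad; have := lc_eps_gt0; lra. Qed.

(** The case [x' = y' = 1] of [lc_difference]. *)
Lemma lc_mul_le x y : dom x -> dom y -> `|c x| < r -> `|c y| < r ->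
  `|c (x * y)%g - c x - c y| <= C * `|c x| * `|c y|.
Proof.
move=> dx dy xr yr.
have d1 := lc_dom1 c; have c1 := lc_fun1 c.
have r1 : `|c 1%g| < r by rewrite c1 normr0 lc_rad_gt0.
have := lc_difference dx d1 dy d1 xr r1 yr r1.
rewrite !mulg1 !mul1g c1 !subr0 => le.
by rewrite addrAC.
Qed.

(** Induction on [j]. Multiplying by one more [x] costs at most [2 * C * j * |c x|^2], which is
    covered by the growth of [C * (j * |c x|)^2] from [j] to [j + 1]. The last bound follows since
    [C * j * |c x| <= 1]. *)
Lemma lc_expg_le x j : dom x -> j%:R * `|c x| < lc_eps ->
  [/\ dom (x ^+ j)%g, `|c (x ^+ j)%g - j%:R *: c x| <= C * (j%:R * `|c x|) ^+ 2
    & `|c (x ^+ j)%g| <= 2 * (j%:R * `|c x|)].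
Proof.
move=> dx; have C0 := lc_const_gt0 c; have C0' := ltW C0.
elim: j => [_|j IH jx].
  rewrite expg0 lc_fun1 scale0r subr0 normr0 mul0r expr0n /= !mulr0.
  by split; [exact: lc_dom1| |].
have nx0 : 0 <= `|c x| by [].
have j0 : 0 <= j%:R :> R by [].
have jx' : j%:R * `|c x| < lc_eps.
  by apply: le_lt_trans jx; rewrite ler_wpM2r// ler_nat.
have xr : `|c x| < lc_eps.
  by apply: le_lt_trans jx; rewrite ler_peMl// ler1n.
have [dj j1 j2] := IH jx'.
have xjr : `|c (x ^+ j)%g| < r by have := lc_eps_rad; lra.
have xr' := lt_eps_rad xr.
have main : `|c (x ^+ j.+1)%g - j.+1%:R *: c x| <= C * (j.+1%:R * `|c x|) ^+ 2.
  rewrite expgSr.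
  have -> : c (x ^+ j * x)%g - j.+1%:R *: c x =
      (c (x ^+ j * x)%g - c (x ^+ j)%g - c x) + (c (x ^+ j)%g - j%:R *: c x).
    by apply/rowP => i; rewrite -natr1 !mxE; ring.
  apply: le_trans (ler_normD _ _) _.
  apply: le_trans (lerD (lc_mul_le dj dx xjr xr') j1) _.
  have : C * `|c (x ^+ j)%g| * `|c x| <= C * (2 * (j%:R * `|c x|)) * `|c x|.
    by rewrite ler_wpM2r// ler_wpM2l// ltW.
  move/(lerD)/(_ (lexx (C * (j%:R * `|c x|) ^+ 2)))/le_trans; apply.
  have -> : C * (2 * (j%:R * `|c x|)) * `|c x| + C * (j%:R * `|c x|) ^+ 2 =
    C * ((2 * j%:R + j%:R ^+ 2) * `|c x| ^+ 2) by ring.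
  rewrite exprMn ler_wpM2l// ler_wpM2r ?exprn_ge0//.
  by rewrite -natr1; lra.
split=> //; first by rewrite expgSr; exact: lc_domM.
have -> : c (x ^+ j.+1)%g = (c (x ^+ j.+1)%g - j.+1%:R *: c x) + j.+1%:R *: c x.
  by rewrite subrK.
apply: le_trans (ler_normD _ _) _.
rewrite normrZ ger0_norm//.
set m := j.+1%:R * `|c x| in jx main *.
have m0 : 0 <= m by rewrite mulr_ge0.
have : C * m ^+ 2 <= m.
  have := lc_eps_const => Ce.
  have : C * m <= 1 by nra.
  by move=> ?; rewrite expr2 mulrA; nra.
by lra.
Qed.

(** The induction carries the sharper [P]: the difference of the powers is [j *: (c x - c y)] up to
    a relative error of order [j * (|c x| + |c y|)]. [PN] reads off the claim from it. *)
Lemma lc_expg_stable x y j : dom x -> dom y ->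
  j%:R * `|c x| < lc_eps -> j%:R * `|c y| < lc_eps ->
  `|c (x ^+ j)%g - c (y ^+ j)%g| <= 2 * j%:R * `|c x - c y|.
Proof.
move=> dx dy; have C0 := lc_const_gt0 c; have C0' := ltW C0.
have d1 := lc_dom1 c; have c1 := lc_fun1 c.
have r1 : `|c 1%g| < r by rewrite c1 normr0 lc_rad_gt0.
set N := `|c x - c y|; have N0 : 0 <= N by rewrite /N.
have px0 : 0 <= `|c x| by []. 
have py0 : 0 <= `|c y| by [].
pose P j := `|c (x ^+ j)%g - c (y ^+ j)%g - j%:R *: (c x - c y)| <=
  C * (j%:R * (`|c x| + `|c y|)) * (j%:R * N).
have PN k : k%:R * `|c x| < lc_eps -> k%:R * `|c y| < lc_eps -> P k ->
    `|c (x ^+ k)%g - c (y ^+ k)%g| <= 2 * k%:R * N.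
  move=> kx ky Pk.
  have -> : c (x ^+ k)%g - c (y ^+ k)%g =
     (c (x ^+ k)%g - c (y ^+ k)%g - k%:R *: (c x - c y)) + k%:R *: (c x - c y).
    by rewrite subrK.
  apply: le_trans (ler_normD _ _) _.
  rewrite normrZ ger0_norm// -/N -mulrA.
  have kN : 0 <= k%:R * N by rewrite mulr_ge0.
  suff : C * (k%:R * (`|c x| + `|c y|)) * (k%:R * N) <= k%:R * N by move: Pk; rewrite /P; lra.
  rewrite ler_piMl//.
  have := lc_eps_const => Ce; rewrite mulrDr.
  have : C * (k%:R * `|c x| + k%:R * `|c y|) <= C * (2 * lc_eps).
    by rewrite ler_wpM2l//; lra.
  by lra.
suff PP k : k%:R * `|c x| < lc_eps -> k%:R * `|c y| < lc_eps -> P k.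
  by move=> jx jy; apply: PN => //; exact: PP.
elim: k => [_ _|k IH kx ky].
  by rewrite /P !expg0 scale0r subr0 subrr normr0 !mul0r mulr0.
have k0 : 0 <= k%:R :> R by [].
have le1 (a : R) : 0 <= a -> a <= k.+1%:R * a by move=> a0; rewrite ler_peMl// ler1n.
have le2 (a : R) : 0 <= a -> k%:R * a <= k.+1%:R * a by move=> a0; rewrite ler_wpM2r// ler_nat.
have kx' := le_lt_trans (le2 _ px0) kx.
have ky' := le_lt_trans (le2 _ py0) ky.
have xr := lt_eps_rad (le_lt_trans (le1 _ px0) kx).
have yr := lt_eps_rad (le_lt_trans (le1 _ py0) ky).
have Pk := IH kx' ky'; have PNk := PN k kx' ky' Pk.
have [dxk _ xkn] := lc_expg_le dx kx'.
have [dyk _ ykn] := lc_expg_le dy ky'.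
have xkr : `|c (x ^+ k)%g| < r by have := lc_eps_rad; lra.
have ykr : `|c (y ^+ k)%g| < r by have := lc_eps_rad; lra.
(* [x ^+ k * x] is compared with [y ^+ k * y] by way of [y ^+ k * x]; each of the two changes is a
   second difference with 1 as one of its arguments. *)
have T1 := lc_difference dxk dyk dx d1 xkr ykr xr r1.
have T2 := lc_difference dyk d1 dx dy ykr r1 xr yr.
rewrite !mulg1 !mul1g c1 !subr0 in T1 T2.
rewrite /P !expgSr.
have -> : c (x ^+ k * x)%g - c (y ^+ k * y)%g - k.+1%:R *: (c x - c y) =
  (c (x ^+ k)%g - c (y ^+ k)%g - k%:R *: (c x - c y)) +
  (c (x ^+ k * x)%g - c (y ^+ k * x)%g - (c (x ^+ k)%g - c (y ^+ k)%g)) +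
  (c (y ^+ k * x)%g - c x - (c (y ^+ k * y)%g - c y)).
  by apply/rowP => i; rewrite -natr1 !mxE; ring.
apply: le_trans (ler_normD _ _) _.
apply: le_trans (lerD (ler_normD _ _) (lexx _)) _.
apply: le_trans (lerD (lerD Pk T1) T2) _.
have : C * `|c (x ^+ k)%g - c (y ^+ k)%g| * `|c x| <= C * (2 * k%:R * N) * `|c x|.
  by rewrite ler_wpM2r// ler_wpM2l// ltW.
have : C * `|c (y ^+ k)%g| * `|c x - c y| <= C * (2 * (k%:R * `|c y|)) * N.
  by rewrite -/N ler_wpM2r// ler_wpM2l// ltW.
move=> h1 h2; apply: le_trans (lerD (lerD (lexx _) h2) h1) _.
have -> : C * (k%:R * (`|c x| + `|c y|)) * (k%:R * N) +
  C * (2 * k%:R * N) * `|c x| + C * (2 * (k%:R * `|c y|)) * N =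
  C * ((k%:R ^+ 2 + 2 * k%:R) * ((`|c x| + `|c y|) * N)) by ring.
have -> : C * (k.+1%:R * (`|c x| + `|c y|)) * (k.+1%:R * N) =
  C * ((k.+1%:R) ^+ 2 * ((`|c x| + `|c y|) * N)) by ring.
rewrite ler_wpM2l// ler_wpM2r// ?mulr_ge0 ?addr_ge0//.
by rewrite -natr1; lra.
Qed.

(** A converse to [lc_expg_le]: as long as the powers stay in the ball of radius [lc_eps], each
    factor moves them by [c x] up to half its length, because [C * lc_eps <= 1 / 2]. The length thus
    grows at least linearly. *)
Lemma lc_no_small_powers x k :
  (forall j, (j <= k)%N -> dom (x ^+ j)%g /\ `|c (x ^+ j)%g| < lc_eps) ->
  k%:R * `|c x| <= 2 * `|c (x ^+ k)%g|.
Proof.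
move=> H; have C0 := lc_const_gt0 c; have C0' := ltW C0.
have [k0|k0] := posnP k; first by rewrite k0 mul0r mulr_ge0.
have [] := H 1%N k0; rewrite expg1 => dx xe.
have Ce := lc_eps_const.
have main j : (j <= k)%N -> `|c (x ^+ j)%g - j%:R *: c x| <= j%:R * (`|c x| / 2).
  elim: j => [_|j IH jk]; first by rewrite expg0 lc_fun1 scale0r subr0 normr0 mul0r.
  have [dj je] := H j (ltnW jk).
  rewrite expgSr.
  have -> : c (x ^+ j * x)%g - j.+1%:R *: c x =
      (c (x ^+ j * x)%g - c (x ^+ j)%g - c x) + (c (x ^+ j)%g - j%:R *: c x).
    by apply/rowP => i; rewrite -natr1 !mxE; ring.
  apply: le_trans (ler_normD _ _) _.
  rewrite -nat1r mulrDl mul1r; apply: lerD; last exact: IH (ltnW jk).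
  apply: le_trans (lc_mul_le dj dx (lt_eps_rad je) (lt_eps_rad xe)) _.
  rewrite mulrC ler_wpM2l//.
  have : C * `|c (x ^+ j)%g| <= C * lc_eps by rewrite ler_wpM2l//; exact: ltW.
  by lra.
have := main k (leqnn k).
have : k%:R * `|c x| <= `|c (x ^+ k)%g| + `|c (x ^+ k)%g - k%:R *: c x|.
  have -> : k%:R * `|c x| = `|k%:R *: c x| by rewrite normrZ ger0_norm.
  have := ler_normB (c (x ^+ k)%g) (c (x ^+ k)%g - k%:R *: c x).
  by rewrite subKr.
by lra.
Qed.

End Powers.

(** * Integer powers and one-parameter subgroups *)

Section IntegerPowers.
Variable G : groupType.
Implicit Types (x : G) (z : int).
Local Open Scope group_scope.

Definition expgz x z : G :=
  match z with Posz k => x ^+ k | Negz k => x ^- k.+1 end.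

Lemma expgz_subn x (m k : nat) : expgz x (m%:Z - k%:Z)%R = x ^+ m * x ^- k.
Proof.
have [km|mk] := leqP k m.
  by rewrite -[m in RHS](subnK km) expgnDr mulgK subzn.
have -> : (m%:Z - k%:Z)%R = Negz (k - m).-1.
  by rewrite NegzE prednK ?subn_gt0// -subzn ?(ltnW mk)// opprB.
rewrite /= prednK ?subn_gt0// -[k in RHS](subnKC (ltnW mk)) expgnDr invgM mulgA.
suff -> : x ^+ m * x ^- (k - m) = x ^- (k - m) * x ^+ m by rewrite mulgK.
by apply: commuteV; exact: commuteX2.
Qed.

Lemma int_subn z : exists m k : nat, z = (m%:Z - k%:Z)%R.
Proof.
case: z => k; first by exists k, 0%N; rewrite subr0.
by exists 0%N, k.+1; rewrite sub0r NegzE.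
Qed.

Lemma expgzD x y z : expgz x (y + z)%R = expgz x y * expgz x z.
Proof.
have [m [k ->]] := int_subn y; have [m' [k' ->]] := int_subn z.
have -> : (m%:Z - k%:Z + (m'%:Z - k'%:Z))%R = ((m + m')%N%:Z - (k + k')%N%:Z)%R.
  by rewrite !PoszD; ring.
rewrite !expgz_subn addnC (addnC k) !expgnDr invgM.
have -> : x ^+ m' * x ^+ m = x ^+ m * x ^+ m' by exact: commuteX2.
rewrite -!mulgA; congr (_ * _); rewrite !mulgA; congr (_ * _).
by apply: commuteV; exact: commuteX2.
Qed.

End IntegerPowers.

Section Morphism.
Variables (G H : groupType) (h : G -> H).
Hypothesis hM : {morph h : x y / (x * y)%g}.
Local Open Scope group_scope.

Lemma morph_g1 : h 1 = 1.
Proof. by apply: (mulgI (h 1)); rewrite -hM !mulg1. Qed.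

Lemma morph_gV x : h x^-1 = (h x)^-1.
Proof. by apply: (mulgI (h x)); rewrite -hM !mulgV morph_g1. Qed.

Lemma morph_gX x k : h (x ^+ k) = h x ^+ k.
Proof. by elim: k => [|k IH]; rewrite ?expg0 ?morph_g1// !expgS hM IH. Qed.

Lemma morph_gz x z : h (expgz x z) = expgz (h x) z.
Proof. by case: z => k; rewrite /= ?morph_gV morph_gX. Qed.

End Morphism.

Section TopologicalGroupLimits.
Variables (L : topologicalGroupType) (T : Type) (F : set_system T).
Hypothesis FF : Filter F.
Implicit Types u v : T -> L.

Lemma cvg_mulg u v (a b : L) : u @ F --> a -> v @ F --> b ->
  (fun i => (u i * v i)%g) @ F --> (a * b)%g.
Proof.
move=> ua vb; have mc := @topmul_continuous L (a, b).
apply: (@cvg_comp _ _ _ (fun i => (u i, v i))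
  (fun xy : L * L => (xy.1 * xy.2)%g) F (nbhs (a, b)) _ _ mc).
exact: cvg_pair.
Qed.

Lemma cvg_invg u (a : L) : u @ F --> a -> (fun i => (u i)^-1%g) @ F --> a^-1%g.
Proof.
move=> ua; have ic := @topinv_continuous L a.
exact: (@cvg_comp _ _ _ u (fun x : L => x^-1%g) F (nbhs a) _ ua ic).
Qed.

End TopologicalGroupLimits.

Section OneParameter.
Variables (R : realType) (L : topologicalGroupType) (X : R -> L).
Hypothesis XP : one_parameter_subgroup X.

Lemma oneparamD s t : X (s + t) = (X s * X t)%g.
Proof. exact: XP.2. Qed.

Lemma oneparam0 : X 0 = 1%g.
Proof. by apply: (mulgI (X 0)); rewrite -oneparamD addr0 mulg1. Qed.

Lemma oneparamN t : X (- t) = (X t)^-1%g.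
Proof. by apply: (mulgI (X t)); rewrite -oneparamD subrr mulgV oneparam0. Qed.

Lemma oneparamX t k : X (k%:R * t) = (X t ^+ k)%g.
Proof.
elim: k => [|k IH]; first by rewrite mul0r oneparam0.
by rewrite -nat1r mulrDl mul1r oneparamD IH expgS.
Qed.

Lemma oneparamz t z : X (z%:~R * t) = expgz (X t) z.
Proof.
case: z => k; first exact: oneparamX.
by rewrite NegzE mulrNz mulNr oneparamN oneparamX.
Qed.

Lemma oneparam_cvg t : X @ t --> X t.
Proof. exact: XP.1. Qed.

Lemma oneparam_cvg1 : X @ 0 --> (1%g : L).
Proof. by rewrite -oneparam0; exact: oneparam_cvg. Qed.

End OneParameter.

(** Continuity at 0 spreads to [t] through [X s = X t * X (s - t)]. *)
Lemma oneparam_of_cvg1 (R : realType) (L : topologicalGroupType) (X : R -> L) :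
  X @ 0 --> (1%g : L) -> (forall s t, X (s + t) = (X s * X t)%g) ->
  one_parameter_subgroup X.
Proof.
move=> X1 XM; split=> // t; rewrite /continuous_at.
have -> : X = fun s => (X t * X (s - t))%g.
  by apply/funext => s; rewrite -XM addrC subrK.
rewrite /= subrr.
have -> : X 0 = 1%g by apply: (mulgI (X 0)); rewrite -XM addr0 mulg1.
apply: cvg_mulg; first exact: cvg_cst.
apply: (@cvg_comp _ _ _ (fun s => s - t) X (nbhs t) (nbhs 0)) => //.
have ct : (fun s : R => s - t) @ t --> t - t.
  by apply: (@continuousB _ _ _ id (fun=> t)); [exact: cvg_id|exact: cst_continuous].
by rewrite subrr in ct.
Qed.

Lemma oneparam_comp (R : realType) (L Q : topologicalGroupType) (h : L -> Q)
    (X : R -> L) :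
  continuous h -> {morph h : x y / (x * y)%g} ->
  one_parameter_subgroup X -> one_parameter_subgroup (h \o X).
Proof.
move=> hc hM [Xc XM]; split=> [t|s t /=]; last by rewrite XM hM.
by apply: (@continuous_comp _ _ _ X h); [exact: Xc|exact: hc].
Qed.

Lemma eq_oneparam_near0 (R : realType) (L : topologicalGroupType) (X Y : R -> L) (d : R) :
  one_parameter_subgroup X -> one_parameter_subgroup Y -> 0 < d ->
  (forall t, 0 <= t <= d -> X t = Y t) -> X = Y.
Proof.
move=> XP YP d0 XY.
have pos t : 0 <= t -> X t = Y t.
  move=> t0; pose k := (Num.truncn (t / d)).+1.
  have kt : t <= k%:R * d by rewrite -ler_pdivrMr// ltW// truncnS_gt.
  have -> : t = k%:R * (t / k%:R) by rewrite mulrC divfK// pnatr_eq0.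
  by rewrite !oneparamX// XY// divr_ge0//= ler_pdivrMr// mulrC.
apply/funext => t; have [t0|t0] := leP 0 t; first exact: pos.
by rewrite -(opprK t) (oneparamN XP) (oneparamN YP) pos// oppr_ge0 ltW.
Qed.

Section Ultra.
Variable R : realType.

(** Closed balls are compact. Limits along one ultrafilter take the place of successive passages to
    subsequences. *)
Lemma ultra_bounded_cvg n (T : Type) (F : set_system T) (u : T -> 'rV[R]_n) (a : R) :
  UltraFilter F -> (\forall i \near F, `|u i| <= a) ->
  exists2 v, u @ F --> v & `|v| <= a.
Proof.
move=> UF ua.
have cA : compact [set v : 'rV[R]_n | `|v| <= a].
  apply: bounded_closed_compact.
    by exists a; split; [exact: num_real|move=> x ax v /le_trans; apply; exact: ltW].
  apply: (closed_comp (f := fun v : 'rV[R]_n => `|v|) (D := [set x | x <= a])).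
    by move=> v _; exact: norm_continuous.
  exact: closed_le.
(* For an ultrafilter every cluster point is a limit. *)
have [v [va vu]] := cA (u @ F) _ ua.
exists v => // U nU.
have [//|FU] := @in_ultra_setVsetC _ F (u @^-1` U) UF.
by have [x []] := vu (~` U) U FU nU.
Qed.

End Ultra.

(** * Limits of powers *)

Section Tangent.
Variables (R : realType) (L : topologicalGroupType) (n : nat).
Variable c : local_chart R L n.

(** [w] is the velocity of [X] at 0 in the chart. With a quadratic remainder, the total error over
    [k] steps of length [t / k] tends to 0. *)
Definition tangent (X : R -> L) (w : 'rV[R]_n) :=
  exists K d : R, [/\ 0 <= K, 0 < d &
    forall t, `|t| < d -> lc_dom c (X t) /\ `|c (X t) - t *: w| <= K * t ^+ 2].

Lemma lc_near1 (e : R) : 0 < e ->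
  \forall x \near (1%g : L), lc_dom c x /\ `|c x| < e.
Proof.
move=> e0; apply: filterI.
  by apply: open_nbhs_nbhs; split; [exact: lc_dom_open|exact: lc_dom1].
have /cvgrPdist_lt/(_ _ e0) := lc_continuous (lc_dom1 c).
by apply: filterS => x; rewrite lc_fun1 sub0r normrN.
Qed.

Lemma lc_inv0 : lc_inv c 0 = 1%g.
Proof. by rewrite -(lc_fun1 c) lc_funK//; exact: lc_dom1. Qed.

Lemma lc_cvg (T : Type) (F : set_system T) (FF : Filter F) (u : T -> L) v :
  (\forall i \near F, lc_dom c (u i)) -> (fun i => c (u i)) @ F --> v ->
  `|v| < lc_rad c -> u @ F --> lc_inv c v.
Proof.
move=> du uv vr.
have h : (fun i => lc_inv c (c (u i))) @ F --> lc_inv c v.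
  exact: (@cvg_comp _ _ _ (fun i => c (u i)) (lc_inv c) F (nbhs v) _ uv
    (lc_inv_continuous vr)).
apply: cvg_trans h; apply: near_eq_cvg.
by apply: filterS du => i di; rewrite lc_funK.
Qed.

Lemma lc_fun_cvg (T : Type) (F : set_system T) (FF : Filter F) (u : T -> L) x :
  lc_dom c x -> u @ F --> x -> (fun i => c (u i)) @ F --> c x.
Proof.
move=> dx ux; exact: (@cvg_comp _ _ _ u c F (nbhs x) _ ux (lc_continuous dx)).
Qed.

(** [lc_mul_le] for [x * x^-1 = 1] bounds the sum by [C * |c x| * |c x^-1|]; since
    [C * |c x| <= 1 / 2], this also yields [|c x^-1| <= 2 * |c x|]. *)
Lemma lc_inv_le x : lc_dom c x -> lc_dom c x^-1%g ->
  `|c x| < lc_eps c -> `|c x^-1%g| < lc_rad c ->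
  `|c x^-1%g + c x| <= 2 * lc_const c * `|c x| ^+ 2.
Proof.
move=> dx dx' xe x'r; have xr := lt_eps_rad xe.
have C0 := lc_const_gt0 c; have Ce := lc_eps_const c.
have := lc_mul_le dx dx' xr x'r.
rewrite mulgV lc_fun1 sub0r -opprD normrN addrC => le.
have Cx : lc_const c * `|c x| <= 1 / 2.
  have : lc_const c * `|c x| <= lc_const c * lc_eps c.
    by rewrite ler_wpM2l// ltW.
  by lra.
have le2 : `|c x^-1%g| <= 2 * `|c x|.
  have : `|c x^-1%g| <= `|c x^-1%g + c x| + `|c x|.
    by rewrite -[X in `|X| <= _](addrK (c x)) ler_normB.
  have : lc_const c * `|c x| * `|c x^-1%g| <= 1 / 2 * `|c x^-1%g|.
    by rewrite ler_wpM2r.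
  by lra.
apply: le_trans le _.
have -> : 2 * lc_const c * `|c x| ^+ 2 = lc_const c * `|c x| * (2 * `|c x|) by ring.
by rewrite ler_wpM2l// mulr_ge0// ltW.
Qed.

End Tangent.

Section LimitSubgroup.
Variables (R : realType) (L : topologicalGroupType) (n : nat).
Variable c : local_chart R L n.
Hypothesis hausL : hausdorff_space L.
Variables (F : set_system nat) (lam : nat -> R) (g : nat -> L) (M : R).
Hypothesis UF : UltraFilter F.
Hypothesis lamF : lam @ F --> +oo.
Hypothesis gdom : \forall i \near F, lc_dom c (g i).
Hypothesis gM : \forall i \near F, lam i * `|c (g i)| <= M.

Let E t i : L := expgz (g i) (Num.floor (t * lam i)).

Let lam_gt a : \forall i \near F, a < lam i.
Proof. by have /cvgryPgt/(_ a) := lamF. Qed.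

Let M_ge0 : 0 <= M.
Proof.
have [i [gi li]] := filter_ex (filterI gM (lam_gt 0)).
by apply: le_trans gi; rewrite mulr_ge0// ltW.
Qed.

Let c_g0 : (fun i => c (g i)) @ F --> (0 : 'rV[R]_n).
Proof.
apply/cvgrPdist_le => e e0; near=> i; rewrite sub0r normrN.
have li : M / e < lam i by near: i; exact: lam_gt.
have li0 : 0 < lam i by near: i; exact: lam_gt.
have gi : lam i * `|c (g i)| <= M by near: i; exact: gM.
rewrite -(ler_pM2l li0); apply: le_trans gi _.
by rewrite -ler_pdivrMr// ltW.
Unshelve. all: by end_near. Qed.

Let g1 : g @ F --> (1%g : L).
Proof.
rewrite -(lc_inv0 c); apply: lc_cvg => //.
by rewrite normr0 lc_rad_gt0.
Qed.

(* [floor] is additive up to an error in [{0, 1}]. *)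
Let E_D s t : exists2 e, e @ F --> (1%g : L) &
  forall i, E (s + t) i = (E s i * E t i * e i)%g.
Proof.
pose z i := Num.floor ((s + t) * lam i) - Num.floor (s * lam i) - Num.floor (t * lam i).
have zE i : z i = 0 \/ z i = 1.
  have := floor_itv ((s + t) * lam i); have := floor_itv (s * lam i).
  have := floor_itv (t * lam i); rewrite /z.
  set a := Num.floor _; set b := Num.floor _; set d := Num.floor _.
  move=> /andP[a1 a2] /andP[b1 b2] /andP[d1 d2].
  have h1 : (a + b)%:~R < (d + 1)%:~R :> R by move: d2; rewrite !intrD; lra.
  have h2 : d%:~R < (a + b + 2)%:~R :> R by move: a2 b2 d1; rewrite !intrD; lra.
  by rewrite !ltr_int in h1 h2; lia.
exists (fun i => expgz (g i) (z i)).
  move=> U U1; have gU : \forall i \near F, U (g i) by exact: g1.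
  suff : \forall i \near F, U (expgz (g i) (z i)) by [].
  apply: filterS gU => i gi.
  have [zi|zi] := zE i; rewrite /= zi /=; last by rewrite expg1.
  by rewrite expg0; exact: nbhs_singleton U1.
by move=> i; rewrite /E -!expgzD /z; congr expgz; ring.
Qed.

Let lim_unique t (y z : L) : E t @ F --> y -> E t @ F --> z -> y = z.
Proof. exact: (@cvg_unique _ hausL). Qed.

Let E_cvgD s t (y z : L) : E s @ F --> y -> E t @ F --> z -> E (s + t) @ F --> (y * z)%g.
Proof.
move=> sy tz; have [e e1 Ee] := E_D s t.
have -> : E (s + t) = (fun i => E s i * E t i * e i)%g by apply/funext.
rewrite -[X in _ --> X]mulg1; apply: cvg_mulg => //; exact: cvg_mulg.
Qed.

Let E0 i : E 0 i = 1%g.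
Proof. by rewrite /E mul0r floor0. Qed.

Let E_cvgN s (y : L) : E s @ F --> y -> E (- s) @ F --> y^-1%g.
Proof.
move=> sy; have [e e1 Ee] := E_D s (- s).
have -> : E (- s) = (fun i => (E s i)^-1 * (e i)^-1)%g.
  apply/funext => i; have := Ee i; rewrite subrr E0 => esi.
  by apply: (mulgI (E s i)); apply: (mulIg (e i)); rewrite -esi mulVKg mulVg.
rewrite -[X in _ --> X]mulg1 -invg1; apply: cvg_mulg; exact: cvg_invg.
Qed.

Let w_ex : {w : 'rV[R]_n | (fun i => lam i *: c (g i)) @ F --> w}.
Proof.
apply: cid.
have [|w ? _] := @ultra_bounded_cvg R n _ F (fun i => lam i *: c (g i)) M UF;
  last by exists w.
near=> i; rewrite normrZ gtr0_norm; last by near: i; exact: lam_gt.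
by near: i; exact: gM.
Unshelve. all: by end_near. Qed.

Let w := sval w_ex.

(** For such [t] the powers stay in the chart, and [lc_expg_le] bounds their coordinates, which
    therefore converge along [F]. As [k i / lam i] tends to [t], the estimate of [lc_expg_le] passes
    to the limit. *)
Let E_small t : 0 <= t -> t * M < lc_eps c ->
  exists y : L, [/\ E t @ F --> y, lc_dom c y
    & `|c y - t *: w| <= lc_const c * (t * M) ^+ 2].
Proof.
move=> t0 tM; have C0 := lc_const_gt0 c.
pose k i := `|Num.floor (t * lam i)|%N.
have kE : \forall i \near F, Posz (k i) = Num.floor (t * lam i).
  near=> i; rewrite /k gez0_abs// floor_ge0 mulr_ge0//.
  by apply: ltW; near: i; exact: lam_gt.
have kle : \forall i \near F, (k i)%:R <= t * lam i.
  apply: filterS kE => i ki; have := floor_le (t * lam i).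
  by rewrite -ki.
have kgt : \forall i \near F, t * lam i < (k i)%:R + 1.
  apply: filterS kE => i ki; have := floorD1_gt (t * lam i).
  by rewrite -ki intrD.
have kg : \forall i \near F, (k i)%:R * `|c (g i)| <= t * M.
  near=> i; apply: (@le_trans _ _ (t * lam i * `|c (g i)|)).
    by rewrite ler_wpM2r//; near: i.
  by rewrite -mulrA ler_wpM2l//; near: i.
have est : \forall i \near F, [/\ lc_dom c (g i ^+ k i)%g,
    `|c (g i ^+ k i)%g - (k i)%:R *: c (g i)| <= lc_const c * (t * M) ^+ 2
    & `|c (g i ^+ k i)%g| <= 2 * (t * M)].
  near=> i.
  have di : lc_dom c (g i) by near: i.
  have kgi : (k i)%:R * `|c (g i)| <= t * M by near: i.
  have [? h1 h2] := lc_expg_le di (le_lt_trans kgi tM).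
  split=> //.
    by apply: le_trans h1 _; rewrite ler_pM2l// lerXn2r// nnegrE ?mulr_ge0.
  by apply: le_trans h2 _; rewrite ler_pM2l.
have [v cv vle] : exists2 v, (fun i => c (g i ^+ k i)%g) @ F --> v & `|v| <= 2 * (t * M).
  by apply: ultra_bounded_cvg; apply: filterS est => i [].
have vr : `|v| < lc_rad c.
  by have := lc_eps_rad c; have := lc_eps_gt0 c; lra.
exists (lc_inv c v); split; last 1 first.
- rewrite lc_invK//.
  have kw : (fun i => (k i)%:R *: c (g i)) @ F --> t *: w.
    have kl : (fun i => (k i)%:R / lam i) @ F --> t.
      apply/cvgrPdist_le => e e0; near=> i.
      have l0 : 0 < lam i by near: i; exact: lam_gt.
      have le : 1 / e < lam i by near: i; exact: lam_gt.
      have k1 : (k i)%:R <= t * lam i by near: i.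
      have k2 : t * lam i < (k i)%:R + 1 by near: i.
      have -> : t - (k i)%:R / lam i = (t * lam i - (k i)%:R) / lam i.
        by rewrite mulrBl mulfK// gt_eqF.
      rewrite ger0_norm ?divr_ge0 ?subr_ge0 ?(ltW l0)// ler_pdivrMr//.
      by rewrite ltr_pdivrMr// in le; lra.
    have h : (fun i => ((k i)%:R / lam i) *: (lam i *: c (g i))) @ F --> t *: w.
      exact: cvgZ kl (svalP w_ex).
    apply: cvg_trans h; apply: near_eq_cvg; near=> i.
    have l0 : 0 < lam i by near: i; exact: lam_gt.
    by rewrite scalerA divfK// gt_eqF.
  have h : (fun i => `|c (g i ^+ k i)%g - (k i)%:R *: c (g i)|) @ F --> `|v - t *: w|.
    by apply: cvg_norm; apply: cvgB.
  by apply: (cvgr_to_le h); apply: filterS est => i [].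
- have h : (fun i => g i ^+ k i)%g @ F --> lc_inv c v.
    by apply: (@lc_cvg _ _ _ c) => //; apply: filterS est => i [].
  apply: cvg_trans h; apply: near_eq_cvg.
  by apply: filterS kE => i ki; rewrite /E -ki.
- exact: lc_inv_dom.
Unshelve. all: by end_near. Qed.

(** A time [s >= 0] is cut into [k] parts to which [E_small] applies, and the limit is raised to the
    power [k]; negative times follow by inversion. *)
Let E_cvg t : exists y : L, E t @ F --> y.
Proof.
have e0 := lc_eps_gt0 c.
have pos s : 0 <= s -> exists y : L, E s @ F --> y.
  move=> s0.
  pose k := (Num.truncn (s * M / lc_eps c)).+1.
  have k0 : 0 < k%:R :> R by rewrite ltr0n.
  have [||y [sy _ _]] := @E_small (s / k%:R).
  - by rewrite divr_ge0.
  - rewrite mulrAC ltr_pdivrMr// [ltRHS]mulrC -ltr_pdivrMr//; exact: truncnS_gt.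
  have H j : E (j%:R * (s / k%:R)) @ F --> (y ^+ j)%g.
    elim: j => [|j IH].
      have -> : E (0%:R * (s / k%:R)) = fun=> 1%g.
        by apply/funext => i; rewrite mul0r E0.
      by rewrite expg0; exact: cvg_cst.
    by rewrite -nat1r mulrDl mul1r expgS; exact: E_cvgD.
  exists (y ^+ k)%g; rewrite -[s](divfK (lt0r_neq0 k0)) mulrC; exact: H.
have [t0|t0] := leP 0 t; first exact: pos.
have [|y ty] := pos (- t); first by rewrite oppr_ge0 ltW.
by exists y^-1%g; rewrite -(opprK t); exact: E_cvgN.
Qed.

(** [E_small] gives the tangent estimate for small [t >= 0], and with it continuity at 0 from the
    right. Inversion carries both over to negative times, the estimate by [lc_inv_le]. *)
Lemma limit_subgroup : exists (Y : R -> L) (w : 'rV[R]_n),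
  [/\ one_parameter_subgroup Y,
      forall t, (fun i => expgz (g i) (Num.floor (t * lam i))) @ F --> Y t,
      (fun i => lam i *: c (g i)) @ F --> w
    & tangent c Y w].
Proof.
have e0 := lc_eps_gt0 c; have C0 := lc_const_gt0 c.
pose Y t := sval (cid (E_cvg t)).
have YE t : E t @ F --> Y t by exact: svalP (cid (E_cvg t)).
have YD s t : Y (s + t) = (Y s * Y t)%g.
  by apply: (@lim_unique (s + t)) => //; exact: E_cvgD.
have YN s : Y (- s) = (Y s)^-1%g.
  by apply: (@lim_unique (- s)) => //; exact: E_cvgN.
pose d := lc_eps c / (M + 1).
have M10 : 0 < M + 1 by rewrite ltr_wpDl.
have d0 : 0 < d by rewrite divr_gt0.
have Ysmall t : 0 <= t -> t < d -> lc_dom c (Y t) /\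
    `|c (Y t) - t *: w| <= lc_const c * M ^+ 2 * t ^+ 2.
  move=> t0 td; have [//||y [ty dy cy]] := @E_small t.
    by move: td; rewrite /d ltr_pdivlMr// mulrDr; lra.
  rewrite -(lim_unique ty (YE t)); split=> //.
  by apply: le_trans cy _; rewrite exprMn; lra.
pose K0 := lc_const c * M ^+ 2.
have K00 : 0 <= K0 by rewrite mulr_ge0 ?exprn_ge0// ltW.
have Y1 : Y 0 = 1%g by apply: (mulgI (Y 0)); rewrite -YD addr0 mulg1.
have Yle t : 0 <= t -> t < d -> t < 1 -> `|c (Y t)| <= (K0 + `|w|) * t.
  move=> t0 td t1; have [_ ct] := Ysmall _ t0 td.
  have := ler_normD (c (Y t) - t *: w) (t *: w).
  rewrite subrK normrZ (ger0_norm t0) => h.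
  have : K0 * t ^+ 2 <= K0 * t by rewrite ler_wpM2l// expr2 ler_piMl// ltW.
  by move: ct; rewrite -/K0; lra.
have Yright U : nbhs (1%g : L) U -> exists2 a : R, 0 < a & forall t, 0 <= t < a -> U (Y t).
  move=> U1.
  have : nbhs (0 : 'rV[R]_n) (lc_inv c @^-1` U).
    have icv : lc_inv c @ (0 : 'rV[R]_n) --> lc_inv c 0.
      by apply: lc_inv_continuous; rewrite normr0 lc_rad_gt0.
    by rewrite lc_inv0 in icv; exact: icv.
  move=> /nbhs_ballP[s /= s0 sU].
  exists (Num.min d (Num.min 1 (s / (K0 + `|w| + 1)))).
    have : 0 < K0 + `|w| + 1 by rewrite ltr_wpDl// addr_ge0.
    by rewrite !lt_min d0 ltr01 => ?; rewrite divr_gt0.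
  move=> t /andP[t0]; rewrite !lt_min => /and3P[td t1 ts].
  have [dt _] := Ysmall _ t0 td.
  rewrite -(lc_funK dt); apply: sU; rewrite -ball_normE /= sub0r normrN.
  apply: le_lt_trans (Yle _ t0 td t1) _.
  move: ts; rewrite ltr_pdivlMr ?ltr_wpDl ?addr_ge0//.
  by rewrite mulrDr mulr1 mulrC; lra.
have Ycvg1 : Y @ 0 --> (1%g : L).
  move=> U U1.
  have V1 : nbhs (1%g : L) (U `&` [set x | U x^-1%g]).
    apply: filterI => //.
    by have := @topinv_continuous L 1%g; rewrite /continuous_at invg1; apply.
  have [a a0 aV] := Yright _ V1.
  apply/nbhs_ballP; exists a => //= t; rewrite -ball_normE /= sub0r normrN => ta.
  have [t0|t0] := leP 0 t.
    by have [] := aV t; rewrite // t0 -(ger0_norm t0).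
  have [|_] := aV (- t); first by rewrite oppr_ge0 ltW// -ltr0_norm.
  by rewrite /= -YN opprK.
have YP : one_parameter_subgroup Y by exact: oneparam_of_cvg1.
exists Y, w; split=> //; first exact: (svalP w_ex).
have r0 := lc_rad_gt0 c.
have /nbhs_ballP[a /= a0 aY] : \forall t \near 0, lc_dom c (Y t) /\ `|c (Y t)| < lc_eps c.
  by have := Ycvg1 _ (lc_near1 c e0).
(* For negative [t] the first summand pays for the inversion of [Y (- t)], whose length is at most
   [(K0 + |w|) * (- t)], and the second for the estimate at [- t]. *)
pose K1 := 2 * lc_const c * (K0 + `|w|) ^+ 2 + K0.
exists K1, (Num.min a (Num.min d 1)); split.
- by rewrite addr_ge0// !mulr_ge0// ?exprn_ge0// ?addr_ge0// ltW.
- by rewrite !lt_min a0 d0 ltr01.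
move=> t; rewrite !lt_min => /and3P[ta td t1].
have inball s : `|s| < a -> ball (0 : R) a s by rewrite -ball_normE /= sub0r normrN.
have [dt te] := aY t (inball _ ta).
split=> //; have [t0|t0] := leP 0 t.
  rewrite (ger0_norm t0) in td.
  have [_ /le_trans] := Ysmall _ t0 td; apply.
  by rewrite ler_wpM2r ?sqr_ge0// lerDr !mulr_ge0// ?exprn_ge0// ?addr_ge0// ltW.
have s0 : 0 <= - t by rewrite oppr_ge0 ltW.
have sd : - t < d by rewrite -ltr0_norm.
have s1 : - t < 1 by rewrite -ltr0_norm.
have [ds cs] := Ysmall _ s0 sd.
have sa : `|- t| < a by rewrite normrN.
have [_ se] := aY (- t) (inball _ sa).
have tE : Y t = (Y (- t))^-1%g by rewrite -YN opprK.
have := @lc_inv_le _ _ _ c (Y (- t)) ds; rewrite -tE => /(_ dt se (lt_eps_rad te)) h.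
have -> : c (Y t) - t *: w = (c (Y t) + c (Y (- t))) - (c (Y (- t)) - (- t) *: w).
  by apply/rowP => i; rewrite !mxE; ring.
apply: le_trans (ler_normB _ _) _.
rewrite /K1 mulrDl; apply: lerD; last by rewrite -[t ^+ 2]sqrrN.
apply: le_trans h _; rewrite -[t ^+ 2]sqrrN -[leRHS]mulrA -exprMn ler_wpM2l//.
  by rewrite mulr_ge0// ltW.
by rewrite lerXn2r ?nnegrE// ?mulr_ge0 ?addr_ge0//; exact: Yle.
Qed.

End LimitSubgroup.

(** * Tangent vectors *)

Lemma exists_ultrafilter_infty :
  exists2 F : set_system nat, UltraFilter F & \oo `<=` F.
Proof. by have [F [UF sF]] := @ultraFilterLemma _ (\oo) _; exists F. Qed.

Section Sequences.
Variables (R : realType) (F : set_system nat) (lam : nat -> R).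
Context {FF : ProperFilter F}.
Hypothesis lamF : lam @ F --> +oo.

Lemma near_gt_pinfty a : \forall i \near F, a < lam i.
Proof. by have /cvgryPgt/(_ a) := lamF. Qed.

Lemma cvg_inv_pinfty a : (fun i => a / lam i) @ F --> (0 : R).
Proof.
apply/cvgrPdist_le => e e0; near=> i; rewrite sub0r normrN.
have l0 : 0 < lam i by near: i; exact: near_gt_pinfty.
have la : `|a| / e < lam i by near: i; exact: near_gt_pinfty.
rewrite normrM normfV (gtr0_norm l0) ler_pdivrMr//.
by rewrite ltr_pdivrMr// [X in _ < X]mulrC in la; exact: ltW.
Unshelve. all: by end_near. Qed.

Lemma cvg_floor_ratio t : (fun i => (Num.floor (t * lam i))%:~R / lam i) @ F --> t.
Proof.
apply/cvgrPdist_le => e e0; near=> i.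
have l0 : 0 < lam i by near: i; exact: near_gt_pinfty.
have la : 1 / e < lam i by near: i; exact: near_gt_pinfty.
have /andP[f1] := floor_itv (t * lam i); rewrite intrD => f2.
have -> : t - (Num.floor (t * lam i))%:~R / lam i =
    (t * lam i - (Num.floor (t * lam i))%:~R) / lam i.
  by rewrite mulrBl mulfK// gt_eqF.
rewrite ger0_norm ?divr_ge0 ?subr_ge0 ?(ltW l0)// ler_pdivrMr//.
by rewrite ltr_pdivrMr// in la; lra.
Unshelve. all: by end_near. Qed.

Lemma cvg_oneparam_floor (L : topologicalGroupType) (X : R -> L) t :
  one_parameter_subgroup X ->
  (fun i => expgz (X (lam i)^-1) (Num.floor (t * lam i))) @ F --> X t.
Proof.
move=> XP; under eq_fun do rewrite -(oneparamz XP).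
apply: (@cvg_comp _ _ _ (fun i => (Num.floor (t * lam i))%:~R / lam i) X F (nbhs t)).
  exact: cvg_floor_ratio.
exact: oneparam_cvg.
Qed.

Lemma cvg_oneparam_inv (L : topologicalGroupType) (X : R -> L) a :
  one_parameter_subgroup X -> (fun i => X (a / lam i)) @ F --> (1%g : L).
Proof.
move=> XP; apply: (@cvg_comp _ _ _ (fun i => a / lam i) X F (nbhs 0)).
  exact: cvg_inv_pinfty.
exact: oneparam_cvg1.
Qed.

Variables (L : topologicalGroupType) (n : nat) (c : local_chart R L n).

Lemma near_lc_cvg1 (u : nat -> L) e : 0 < e -> u @ F --> (1%g : L) ->
  \forall i \near F, lc_dom c (u i) /\ `|c (u i)| < e.
Proof. by move=> e0 u1; exact: (u1 _ (lc_near1 c e0)). Qed.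

(** After rescaling by [lam] the error [C * |c (u i)| * |c (v i)|] is a bounded factor times one
    that tends to 0, so products turn into sums. *)
Lemma cvg_rescaled_mul (u v : nat -> L) (w w' : 'rV[R]_n) :
  u @ F --> (1%g : L) -> v @ F --> (1%g : L) ->
  (fun i => lam i *: c (u i)) @ F --> w ->
  (fun i => lam i *: c (v i)) @ F --> w' ->
  (fun i => lam i *: c (u i * v i)%g) @ F --> w + w'.
Proof.
move=> u1 v1 uw vw.
have r0 := lc_rad_gt0 c.
pose m i := c (u i * v i)%g - c (u i) - c (v i).
have v0 : (fun i => `|c (v i)|) @ F --> (0 : R).
  rewrite -(normr0 'rV[R]_n) -(lc_fun1 c).
  by apply: cvg_norm; apply: lc_fun_cvg v1; exact: lc_dom1.
have m0 : (fun i => lam i *: m i) @ F --> (0 : 'rV[R]_n).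
  have b0 : (fun i => lc_const c * `|lam i *: c (u i)| * `|c (v i)|) @ F --> (0 : R).
    rewrite -[X in _ --> X](mulr0 (lc_const c * `|w|)).
    apply: cvgM => //; apply: cvgM; first exact: cvg_cst.
    exact: cvg_norm.
  apply/cvgrPdist_le => e e0; near=> i; rewrite sub0r normrN normrZ.
  have l0 : 0 < lam i by near: i; exact: near_gt_pinfty.
  have [du ur] : lc_dom c (u i) /\ `|c (u i)| < lc_rad c by near: i; exact: near_lc_cvg1.
  have [dv vr] : lc_dom c (v i) /\ `|c (v i)| < lc_rad c by near: i; exact: near_lc_cvg1.
  have be : lc_const c * `|lam i *: c (u i)| * `|c (v i)| <= e.
    by apply: le_trans (ler_norm _) _; near: i; exact: cvgr0_norm_le b0 _ e0.
  apply: le_trans be; rewrite normrZ (gtr0_norm l0).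
  have := lc_mul_le du dv ur vr; rewrite -/(m i) => mi.
  have -> : lc_const c * (lam i * `|c (u i)|) * `|c (v i)| =
    lam i * (lc_const c * `|c (u i)| * `|c (v i)|) by ring.
  by rewrite ler_pM2l.
have -> : (fun i => lam i *: c (u i * v i)%g) =
  (fun i => lam i *: m i + (lam i *: c (u i) + lam i *: c (v i))).
  by apply/funext => i; apply/rowP => k; rewrite /m !mxE; ring.
by rewrite -[X in _ --> X]add0r; apply: cvgD => //; apply: cvgD.
Unshelve. all: by end_near. Qed.

Lemma cvg_tangent (X : R -> L) w a : tangent c X w ->
  (fun i => lam i *: c (X (a / lam i))) @ F --> a *: w.
Proof.
move=> [K [d [K0 d0 XK]]].
apply/cvgrPdist_le => e e0; near=> i.
have l0 : 0 < lam i by near: i; exact: near_gt_pinfty.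
have ld : `|a| / d < lam i by near: i; exact: near_gt_pinfty.
have le : K * a ^+ 2 / e < lam i by near: i; exact: near_gt_pinfty.
have ad : `|a / lam i| < d.
  by rewrite normrM normfV (gtr0_norm l0) ltr_pdivrMr// mulrC -ltr_pdivrMr.
have [_ Xa] := XK _ ad.
have -> : a *: w - lam i *: c (X (a / lam i)) =
    - (lam i *: (c (X (a / lam i)) - (a / lam i) *: w)).
  by rewrite scalerBr scalerA [lam i * _]mulrC divfK ?gt_eqF// opprB.
rewrite normrN normrZ (gtr0_norm l0).
apply: le_trans (ler_wpM2l (ltW l0) Xa) _.
have -> : lam i * (K * (a / lam i) ^+ 2) = K * a ^+ 2 / lam i.
  by field; rewrite gt_eqF.
rewrite ltr_pdivrMr// in le.
by rewrite ler_pdivrMr// [leRHS]mulrC ltW.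
Unshelve. all: by end_near. Qed.

End Sequences.

Section TangentVectors.
Variables (R : realType) (L : topologicalGroupType) (n : nat).
Variable c : local_chart R L n.
Hypothesis hausL : hausdorff_space L.

Definition natS i : R := i.+1%:R.

Lemma cvg_natS (F : set_system nat) {FF : Filter F} : \oo `<=` F -> natS @ F --> +oo.
Proof.
move=> sF; apply/cvgryPgt => a; apply: sF.
exists (Num.truncn a) => //= i /= ai.
apply: lt_le_trans (truncnS_gt a) _.
by rewrite ler_nat ltnS.
Qed.

(** For the sequence [X (natS i)^-1] the limit subgroup is [X] itself, by [cvg_oneparam_floor]. The
    bound that [limit_subgroup] requires comes from [lc_no_small_powers]. *)
Lemma tangent_exists (X : R -> L) : one_parameter_subgroup X ->
  exists w, tangent c X w.
Proof.
move=> XP; have e0 := lc_eps_gt0 c.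
have [F UF sF] := exists_ultrafilter_infty.
have lamF : natS @ F --> +oo by exact: cvg_natS.
have /nbhs_ballP[d /= d0 dX] : \forall t \near 0, lc_dom c (X t) /\ `|c (X t)| < lc_eps c.
  by have := oneparam_cvg1 XP (lc_near1 c e0).
have small t : `|t| < d -> lc_dom c (X t) /\ `|c (X t)| < lc_eps c.
  by move=> td; apply: dX; rewrite -ball_normE /= sub0r normrN.
have near_small : \forall i \near F, `|(natS i)^-1| < d.
  near=> i; have l0 : 0 < natS i by near: i; exact: (near_gt_pinfty lamF).
  have : 1 / d < natS i by near: i; exact: (near_gt_pinfty lamF).
  by rewrite normfV (gtr0_norm l0) => ?; rewrite -[ltLHS]mul1r ltr_pdivrMr// mulrC -ltr_pdivrMr.
have [||Y [w [YP YX _ Yw]]] := @limit_subgroup _ _ _ c hausL F natS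
    (fun i => X (natS i)^-1) (6 * lc_eps c / d) UF lamF.
- by apply: filterS near_small => i /small[].
- near=> i.
  have l0 : 0 < natS i by near: i; exact: (near_gt_pinfty lamF).
  have /small[dXi Xie] : `|(natS i)^-1| < d by near: i.
  (* The first [k] powers are values of [X] at times up to [d / 2], hence lie in the ball, and
     [k.+1] times the length of [X (natS i)^-1] is at most [3 * lc_eps c]. As
     [k.+1 > natS i * d / 2], the bound [6 * lc_eps c / d] results. *)
  pose k := Num.truncn (natS i * d / 2).
  have ld0 : 0 <= natS i * d / 2 by rewrite !mulr_ge0// ltW.
  have /andP[k1 k2] := truncn_itv ld0.
  have := @lc_no_small_powers _ _ _ c (X (natS i)^-1) k.
  rewrite -!(oneparamX XP) => H.
  have kd j : (j <= k)%N -> `|j%:R / natS i| < d.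
    move=> jk; rewrite ger0_norm ?divr_ge0 ?(ltW l0)// ltr_pdivrMr//.
    apply: (@le_lt_trans _ _ (natS i * d / 2)).
      by apply: le_trans k1; rewrite ler_nat.
    have := mulr_gt0 l0 d0; lra.
  have {}H : k%:R * `|c (X (natS i)^-1)| <= 2 * `|c (X (k%:R / natS i))|.
    by apply: H => j jk; rewrite -(oneparamX XP); apply: small; exact: kd.
  have [_ Xk] := small _ (kd k (leqnn k)).
  rewrite -(ler_pM2r (_ : 0 < d / 2)) ?divr_gt0//.
  have -> : 6 * lc_eps c / d * (d / 2) = 3 * lc_eps c.
    by field; rewrite gt_eqF.
  rewrite mulrAC mulrA.
  apply: (@le_trans _ _ (k.+1%:R * `|c (X (natS i)^-1)|)).
    by rewrite ler_wpM2r// ltW.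
  rewrite -natr1 mulrDl mul1r; lra.
suff -> : X = Y by exists w.
apply/funext => t; apply: (@cvg_unique _ hausL _ _ _ _ _ (YX t)).
exact: cvg_oneparam_floor.
Unshelve. all: by end_near. Qed.

(** The points with coordinates [w / natS i] are fed to [limit_subgroup]; rescaled, their
    coordinates are eventually constant. *)
Lemma tangent_surj w : exists2 X : R -> L, one_parameter_subgroup X & tangent c X w.
Proof.
have [F UF sF] := exists_ultrafilter_infty.
have lamF : natS @ F --> +oo by exact: cvg_natS.
have nr : \forall i \near F, `|(natS i)^-1 *: w| < lc_rad c.
  near=> i; have l0 : 0 < natS i by near: i; exact: (near_gt_pinfty lamF).
  have : `|w| / lc_rad c < natS i by near: i; exact: (near_gt_pinfty lamF).
  rewrite normrZ normfV (gtr0_norm l0) => ?.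
  by rewrite mulrC ltr_pdivrMr// mulrC -ltr_pdivrMr// lc_rad_gt0.
have lE : \forall i \near F, natS i *: c (lc_inv c ((natS i)^-1 *: w)) = w.
  near=> i; have l0 : 0 < natS i by near: i; exact: (near_gt_pinfty lamF).
  by rewrite lc_invK; [rewrite scalerA divff ?gt_eqF// scale1r|near: i].
have [||Y [w' [YP _ gw Yw]]] := @limit_subgroup _ _ _ c hausL F natS
    (fun i => lc_inv c ((natS i)^-1 *: w)) `|w| UF lamF.
- by apply: filterS nr => i; exact: lc_inv_dom.
- near=> i; have l0 : 0 < natS i by near: i; exact: (near_gt_pinfty lamF).
  rewrite -[X in X * _](gtr0_norm l0) -normrZ.
  by have -> : natS i *: c (lc_inv c ((natS i)^-1 *: w)) = w by near: i.
exists Y => //; suff -> : w = w' by [].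
apply: (@cvg_unique _ (@norm_hausdorff _ _) _ _ _ _ _ gw).
by apply: cvg_near_cst; apply: filterS lE => i ->.
Unshelve. all: by end_near. Qed.

(** For small [t], [X t] and [Y t] are the [k]-th powers of [X (t / k)] and [Y (t / k)], whose
    coordinates differ by O((t / k)^2). By [lc_expg_stable] those of [X t] and [Y t] differ by O(t^2
    / k) for every [k]. *)
Lemma tangent_inj (X Y : R -> L) w : one_parameter_subgroup X ->
  one_parameter_subgroup Y -> tangent c X w -> tangent c Y w -> X = Y.
Proof.
move=> XP YP [K [d [K0 d0 XK]]] [K' [d' [K'0 d'0 YK]]].
have e0 := lc_eps_gt0 c.
pose B := K + K' + `|w| + 1.
have B0 : 0 < B by rewrite ltr_wpDl// !addr_ge0.
(* The minimum ensures [B * t < lc_eps c], and halving turns [t <= a] into strict inequalities. *)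
pose a := Num.min (Num.min d d') (Num.min 1 (lc_eps c / B)) / 2.
have a20 : 0 < Num.min (Num.min d d') (Num.min 1 (lc_eps c / B)).
  by rewrite !lt_min d0 d'0 ltr01 divr_gt0.
apply: (@eq_oneparam_near0 _ _ X Y a) => //; first by rewrite divr_gt0.
move=> t /andP[t0 ta].
have : t < Num.min (Num.min d d') (Num.min 1 (lc_eps c / B)).
  by apply: le_lt_trans ta _; rewrite /a; lra.
rewrite !lt_min => /andP[/andP[td td'] /andP[t1 tB]].
rewrite ltr_pdivlMr// in tB.
have bound s : 0 <= s -> s <= t -> [/\ lc_dom c (X s), lc_dom c (Y s),
   `|c (X s)| <= B * s, `|c (Y s)| <= B * s & `|c (X s) - c (Y s)| <= (K + K') * s ^+ 2].
  move=> s0 st.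
  have [dX cX] : lc_dom c (X s) /\ `|c (X s) - s *: w| <= K * s ^+ 2.
    by apply: XK; rewrite ger0_norm//; exact: le_lt_trans td.
  have [dY cY] : lc_dom c (Y s) /\ `|c (Y s) - s *: w| <= K' * s ^+ 2.
    by apply: YK; rewrite ger0_norm//; exact: le_lt_trans td'.
  have s2 : s ^+ 2 <= s by rewrite expr2 ler_piMl//; lra.
  have Ks2 : K * s ^+ 2 <= K * s by rewrite ler_wpM2l.
  have K's2 : K' * s ^+ 2 <= K' * s by rewrite ler_wpM2l.
  have Ks : 0 <= K * s by rewrite mulr_ge0.
  have K's : 0 <= K' * s by rewrite mulr_ge0.
  have nw : `|s *: w| = `|w| * s by rewrite normrZ ger0_norm// mulrC.
  split=> //.
  - have := ler_normD (c (X s) - s *: w) (s *: w); rewrite subrK nw /B; lra.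
  - have := ler_normD (c (Y s) - s *: w) (s *: w); rewrite subrK nw /B; lra.
  - have -> : c (X s) - c (Y s) = (c (X s) - s *: w) - (c (Y s) - s *: w).
      by rewrite opprB addrA subrK.
    by apply: le_trans (ler_normB _ _) _; lra.
have [dX dY _ _ _] := bound t t0 (lexx t).
rewrite -(lc_funK dX) -(lc_funK dY); congr (lc_inv c _).
apply/eqP; rewrite -subr_eq0 -normr_le0; apply/ler_addgt0Pl => e e'0.
rewrite addr0.
pose k := (Num.truncn (2 * (K + K') * t ^+ 2 / e)).+1.
have k0 : 0 < k%:R :> R by rewrite ltr0n.
have tk0 : 0 <= t / k%:R by rewrite divr_ge0.
have tkt : t / k%:R <= t by rewrite ler_pdivrMr// ler_peMr// ler1n.
have [dXk dYk Xk Yk XYk] := bound _ tk0 tkt.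
have tE : t = k%:R * (t / k%:R) by rewrite mulrC divfK// gt_eqF.
have kB : k%:R * (B * (t / k%:R)) < lc_eps c.
  by rewrite mulrCA -tE mulrC.
have := @lc_expg_stable _ _ _ c _ _ k dXk dYk.
rewrite -!(oneparamX XP) -!(oneparamX YP) -tE => /(_ _ _)/le_trans; apply.
- by apply: le_lt_trans kB; rewrite ler_pM2l.
- by apply: le_lt_trans kB; rewrite ler_pM2l.
apply: (@le_trans _ _ (2 * k%:R * ((K + K') * (t / k%:R) ^+ 2))).
  by rewrite ler_pM2l// mulr_gt0.
have -> : 2 * k%:R * ((K + K') * (t / k%:R) ^+ 2) = 2 * (K + K') * t ^+ 2 / k%:R.
  by field; rewrite gt_eqF.
rewrite ler_pdivrMr// [leRHS]mulrC -ler_pdivrMr//.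
exact: ltW (truncnS_gt _).
Qed.

Lemma tangent_unique (X : R -> L) w w' : tangent c X w -> tangent c X w' -> w = w'.
Proof.
move=> Xw Xw'; have [F UF sF] := exists_ultrafilter_infty.
have lamF : natS @ F --> +oo by exact: cvg_natS.
have h v : tangent c X v -> (fun i => natS i *: c (X (1 / natS i))) @ F --> v.
  by move=> Xv; rewrite -[v in _ --> v]scale1r; exact: cvg_tangent.
exact: (cvg_unique (@norm_hausdorff R 'rV[R]_n) (h _ Xw) (h _ Xw')).
Qed.

(** This is the Lie product formula. The limit is part of the conclusion because it describes [Z] by
    group operations alone, which homomorphisms preserve. *)
Lemma tangent_combination (F : set_system nat) (X Y : R -> L) w w' a b :
  UltraFilter F -> \oo `<=` F ->
  one_parameter_subgroup X -> one_parameter_subgroup Y ->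
  tangent c X w -> tangent c Y w' ->
  exists Z : R -> L, [/\ one_parameter_subgroup Z, tangent c Z (a *: w + b *: w')
    & forall t, (fun i => expgz (X (a / natS i)%R * Y (b / natS i)%R)%g
                  (Num.floor (t * natS i))) @ F --> Z t].
Proof.
move=> UF sF XP YP Xw Yw.
have lamF : natS @ F --> +oo by exact: cvg_natS.
have X1 : (fun i => X (a / natS i)) @ F --> (1%g : L) by exact: cvg_oneparam_inv.
have Y1 : (fun i => Y (b / natS i)) @ F --> (1%g : L) by exact: cvg_oneparam_inv.
have XYw : (fun i => natS i *: c (X (a / natS i)%R * Y (b / natS i)%R)%g) @ F -->
    a *: w + b *: w'.
  by apply: (cvg_rescaled_mul lamF) => //; exact: cvg_tangent.
have XYM : \forall i \near F, `|natS i *: c (X (a / natS i)%R * Y (b / natS i)%R)%g|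
    <= `|a *: w + b *: w'| + 1.
  by apply: (cvgr_norm_le (a *: w + b *: w')) => //; rewrite ltrDl.
have [||Z [w'' [ZP Zl gw Zw]]] := @limit_subgroup _ _ _ c hausL F natS
    (fun i => X (a / natS i)%R * Y (b / natS i)%R)%g (`|a *: w + b *: w'| + 1) UF lamF.
- have XY1 := cvg_mulg _ X1 Y1; rewrite mulg1 in XY1.
  by apply: filterS (near_lc_cvg1 c ltr01 (XY1 _)) => i [].
- near=> i; have l0 : 0 < natS i by near: i; exact: (near_gt_pinfty lamF).
  rewrite -[X in X * _](gtr0_norm l0) -normrZ.
  by near: i.
exists Z; split=> //.
by rewrite (cvg_unique (@norm_hausdorff R 'rV[R]_n) XYw gw).
Unshelve. all: by end_near. Qed.

End TangentVectors.

(** * Lifting along quotients of Lie groups *)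

Lemma oneparam_lift_lie (R : realType) (L Q : topologicalGroupType) n
    (c : local_chart R L n) (h : L -> Q) (X : R -> Q) :
  hausdorff_space L -> hausdorff_space Q -> quotient_morphism h ->
  one_parameter_subgroup X ->
  exists2 Y : R -> L, one_parameter_subgroup Y & X = h \o Y.
Proof.
move=> hausL hausQ [hM hC hO hS] XP.
have [F UF sF] := exists_ultrafilter_infty.
pose lam : nat -> R := @natS R.
have lamF : lam @ F --> +oo by exact: cvg_natS.
have lam0 i : 0 < lam i by rewrite ltr0n.
have r0 := lc_rad_gt0 c; have e0 := lc_eps_gt0 c.
pose lifts (e : R) i := [set g : L | [/\ lc_dom c g, `|c g| < e & h g = X (lam i)^-1]].
(* As [h] is open, it maps neighbourhoods of 1 to neighbourhoods of 1, which eventually contain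
   [X (1 / lam i)]. *)
have near_lifts e : 0 < e -> \forall i \near F, lifts e i !=set0.
  move=> e_gt0.
  have : nbhs (1%g : L) [set x | lc_dom c x /\ `|c x| < e] by exact: lc_near1.
  rewrite nbhsE => -[B [oB B1] BU].
  have hB : nbhs (1%g : Q) (h @` B).
    by apply: open_nbhs_nbhs; split; [exact: hO|exists 1%g => //; exact: morph_g1].
  have X1 : (fun i => X (1 / lam i)) @ F --> (1%g : Q) by exact: cvg_oneparam_inv.
  have : \forall i \near F, (h @` B) (X (1 / lam i)) by exact: X1.
  apply: filterS => i [g Bg hg]; have [dg cg] := BU _ Bg.
  by exists g; split=> //; rewrite hg div1r.
(* The infimum of the lengths need not be attained, so a slack of [1 / lam i] is allowed. Where no
   lift exists the choice is 1. *)
have /choice[g gP] : forall i, exists g, lifts (lc_rad c) i !=set0 ->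
    lifts (lc_rad c) i g /\
    forall g', lifts (lc_rad c) i g' -> `|c g| <= `|c g'| + (lam i)^-1.
  move=> i; have [[g0 g0P]|nl] := pselect (lifts (lc_rad c) i !=set0); last by exists 1%g.
  pose S := [set `|c g| | g in lifts (lc_rad c) i].
  have lS : has_inf S by split; [exists `|c g0|, g0|exists 0 => _ [x _ <-]].
  have li0 : 0 < (lam i)^-1 by rewrite invr_gt0.
  have [_ [g gl <-] gi] := inf_adherent li0 lS.
  exists g => _; split=> // g' g'l.
  apply: le_trans (ltW gi) _; rewrite lerD2r.
  by apply: ge_inf; [case: lS|exists g'].
have gl : \forall i \near F, lifts (lc_rad c) i (g i) /\
    forall g', lifts (lc_rad c) i g' -> `|c (g i)| <= `|c g'| + (lam i)^-1.
  by apply: filterS (near_lifts _ r0) => i /gP.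
have gd : \forall i \near F, lc_dom c (g i) by apply: filterS gl => i [[]].
have hg : \forall i \near F, h (g i) = X (lam i)^-1 by apply: filterS gl => i [[]].
have lamV : (fun i => (lam i)^-1) @ F --> (0 : R).
  by under eq_fun do rewrite -div1r; exact: cvg_inv_pinfty.
have cg0 : (fun i => `|c (g i)|) @ F --> (0 : R).
  apply/cvgrPdist_le => e e_gt0.
  have me : 0 < Num.min (lc_rad c) (e / 2) by rewrite lt_min r0 divr_gt0.
  near=> i; rewrite sub0r normrN normr_id.
  have [_ gmin] : lifts (lc_rad c) i (g i) /\
    forall g', lifts (lc_rad c) i g' -> `|c (g i)| <= `|c g'| + (lam i)^-1 by near: i.
  have [g' [dg' + hg']] : lifts (Num.min (lc_rad c) (e / 2)) i !=set0.
    by near: i; exact: (near_lifts _ me).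
  rewrite lt_min => /andP[g'r g'e].
  have lV : `|(lam i)^-1| <= e / 2.
    by near: i; apply: cvgr0_norm_le lamV _ _; rewrite divr_gt0.
  have := gmin g' (And3 dg' g'r hg').
  rewrite gtr0_norm ?invr_gt0// in lV => gi; apply: (le_trans gi).
  by rewrite [leRHS](splitr e) lerD// ltW.
have g1 : g @ F --> (1%g : L).
  rewrite -(lc_inv0 c); apply: lc_cvg => //; last by rewrite normr0.
  by apply/norm_cvg0P.
(* Used with [mu = lam] in the bounded case and with [mu i = 1 / |c (g i)|] in the other. *)
have hlim (mu : nat -> R) (Z : R -> L) t :
    (fun i => expgz (g i) (Num.floor (t * mu i))) @ F --> Z t ->
    (fun i => X ((Num.floor (t * mu i))%:~R / lam i)) @ F --> h (Z t).
  move=> gZ.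
  have hgZ : (fun i => h (expgz (g i) (Num.floor (t * mu i)))) @ F --> h (Z t).
    exact: (@cvg_comp _ _ _ (fun i => expgz (g i) (Num.floor (t * mu i))) h F
      (nbhs (Z t)) _ gZ (hC _)).
  apply: cvg_trans hgZ; apply: near_eq_cvg.
  by apply: filterS hg => i hgi; rewrite (morph_gz hM) hgi (oneparamz XP).
have [[M gM]|unbounded] := pselect (exists M, \forall i \near F, lam i * `|c (g i)| <= M).
  have [Y [w [YP Ylim _ _]]] := @limit_subgroup _ _ _ c hausL F lam g M UF lamF gd gM.
  exists Y => //; apply/funext => t /=.
  have h1 : (fun i => X ((Num.floor (t * lam i))%:~R / lam i)) @ F --> h (Y t) by exact: hlim.
  have h2 : (fun i => X ((Num.floor (t * lam i))%:~R / lam i)) @ F --> X t.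
    apply: (@cvg_comp _ _ _ (fun i => (Num.floor (t * lam i))%:~R / lam i) X F (nbhs t)).
      exact: cvg_floor_ratio.
    exact: oneparam_cvg.
  exact: (cvg_unique hausQ h2 h1).
exfalso.
(* An ultrafilter contains each set or its complement, so unboundedness means divergence to infinity
   along [F]. *)
have gM M : \forall i \near F, M < lam i * `|c (g i)|.
  have [FM|] := @in_ultra_setVsetC _ F [set i | lam i * `|c (g i)| <= M] UF.
    by exfalso; apply: unbounded; exists M.
  apply: filterS => i /= /negP; by rewrite -ltNge.
have cgpos : \forall i \near F, 0 < `|c (g i)|.
  by apply: filterS (gM 0) => i; rewrite pmulr_rgt0.
pose mu i := `|c (g i)|^-1.
have muF : mu @ F --> +oo.
  apply/cvgryPgt => A; near=> i.
  have ci : 0 < `|c (g i)| by near: i.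
  have A1 : 0 < `|A| + 1 by rewrite ltr_wpDl.
  have : `| `|c (g i)| | < (`|A| + 1)^-1.
    by near: i; apply: cvgr0_norm_lt cg0 _ _; rewrite invr_gt0.
  rewrite normr_id => cA.
  apply: (@lt_trans _ _ (`|A| + 1)).
    by apply: le_lt_trans (ler_norm A) _; rewrite ltrDl.
  by rewrite /mu -[ltLHS]invrK ltf_pV2 ?posrE ?invr_gt0//.
have mug : \forall i \near F, `|mu i *: c (g i)| = 1.
  near=> i; have ci : 0 < `|c (g i)| by near: i.
  by rewrite normrZ /mu normfV normr_id mulVf// gt_eqF.
have mug' : \forall i \near F, mu i * `|c (g i)| <= 1.
  near=> i; have ci : 0 < `|c (g i)| by near: i.
  by rewrite /mu mulVf// gt_eqF.
have [Z [w [ZP Zlim gw Zw]]] := @limit_subgroup _ _ _ c hausL F mu g 1 UF muF gd mug'.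
(* The ratio is the inverse of [lam i * |c (g i)|]. Hence [floor (t * mu i) / lam i] tends to 0,
   which puts [Z t] in the kernel of [h]. *)
have mulam : (fun i => mu i / lam i) @ F --> (0 : R).
  apply/cvgrPdist_le => e e_gt0; near=> i; rewrite sub0r normrN.
  have ci : 0 < `|c (g i)| by near: i.
  have eM : e^-1 < lam i * `|c (g i)| by near: i; exact: gM.
  rewrite /mu -invfM ger0_norm ?invr_ge0 ?mulr_ge0 ?(ltW (lam0 i))//.
  rewrite -[leRHS]invrK lef_pV2 ?posrE ?invr_gt0 ?mulr_gt0//.
  by rewrite mulrC ltW.
have hZ t : h (Z t) = 1%g.
  have h1 := hlim mu Z t (Zlim t).
  have h2 : (fun i => X ((Num.floor (t * mu i))%:~R / lam i)) @ F --> (1%g : Q).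
    apply: (@cvg_comp _ _ _ (fun i => (Num.floor (t * mu i))%:~R / lam i) X F (nbhs 0));
      last exact: oneparam_cvg1.
    have h3 : (fun i => ((Num.floor (t * mu i))%:~R / mu i) * (mu i / lam i)) @ F --> (0 : R).
      rewrite -[X in _ --> X](mulr0 t); apply: cvgM => //.
      exact: cvg_floor_ratio.
    apply: cvg_trans h3; apply: near_eq_cvg; near=> i.
    have ci : 0 < mu i by rewrite invr_gt0; near: i.
    by rewrite mulrA divfK// gt_eqF.
  exact: (cvg_unique hausQ h1 h2).
(* As [Z] lies in the kernel of [h], [k i] is again a lift of [X (lam i)^-1], but
   its length is [o(|c (g i)|)]. *)
pose k i := (g i * Z (-1 / mu i)%R)%g.
have Z1 : (fun i => Z (-1 / mu i)) @ F --> (1%g : L) by exact: cvg_oneparam_inv.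
have k1 : k @ F --> (1%g : L) by rewrite -[1%g]mulg1; exact: cvg_mulg.
have kw : (fun i => mu i *: c (k i)) @ F --> w + -1 *: w.
  by apply: (cvg_rescaled_mul muF) => //; exact: cvg_tangent.
rewrite scaleN1r subrr in kw.
have klift : \forall i \near F, lifts (lc_rad c) i (k i).
  near=> i.
  have [dk ck] : lc_dom c (k i) /\ `|c (k i)| < lc_rad c by near: i; exact: near_lc_cvg1.
  split=> //; rewrite /k hM hZ mulg1; by near: i.
(* Multiplied by [mu i], the almost minimality of [g i] against the lift [k i] reads
   [1 <= 1 / 4 + 1 / 4]. *)
have : \forall i \near F, False.
  near=> i.
  have ci : 0 < `|c (g i)| by near: i.
  have mi : 0 < mu i by rewrite invr_gt0.
  have [_ gmin] : lifts (lc_rad c) i (g i) /\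
    forall g', lifts (lc_rad c) i g' -> `|c (g i)| <= `|c g'| + (lam i)^-1 by near: i.
  have ki : lifts (lc_rad c) i (k i) by near: i.
  have k4 : `|mu i *: c (k i)| <= 1 / 4 by near: i; apply: cvgr0_norm_le kw _ _; lra.
  have m4 : `|mu i / lam i| <= 1 / 4 by near: i; apply: cvgr0_norm_le mulam _ _; lra.
  have := gmin _ ki; rewrite -(ler_pM2l mi) mulrDr {1}/mu mulVf ?gt_eqF//.
  rewrite normrZ gtr0_norm// in k4; rewrite gtr0_norm ?divr_gt0// in m4.
  move=> /le_trans/(_ (lerD k4 m4)); rewrite leNgt => /negP; apply.
  lra.
by move=> /filter_ex[].
Unshelve. all: by end_near. Qed.

(** * Linear compactness *)

Section LinearCompactness.
Variables (R : fieldType) (I : Type) (n : I -> nat).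
Local Notation P := (forall i, 'rV[R]_(n i)).

Definition affine_combination (a : R) (x y : P) : P :=
  fun i => (1 - a) *: x i + a *: y i.

Definition affine_set (S : set P) :=
  forall x y a, S x -> S y -> S (affine_combination a x y).

(** A filter base of nonempty affine subsets of the product. *)
Definition affine_base (D : set (set P)) :=
  (forall A, D A -> affine_set A /\ A !=set0) /\
  (forall A B, D A -> D B -> exists2 C, D C & C `<=` A `&` B).

(** Zorn's lemma: two members of the union of a chain of bases lie in one of these, so the union is
    again a base. *)
Lemma affine_base_maximal (D : set (set P)) : affine_base D ->
  exists M, [/\ affine_base M, D `<=` M &
    forall M', affine_base M' -> M `<=` M' -> M' `<=` M].
Proof.
move=> bD.
(* The order is on the sets [S] added to [D], so that the empty chain, too, yields a base, namely
   [D]. *)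
have [F FF UF|S [bS maxS]] := @Zorn_bigcup (set P) (fun S => affine_base (D `|` S)).
  have common A B : (D `|` \bigcup_(S in F) S) A -> (D `|` \bigcup_(S in F) S) B ->
      exists S, [/\ affine_base (D `|` S), D `|` S `<=` D `|` \bigcup_(S in F) S,
        (D `|` S) A & (D `|` S) B].
    have sub S : F S -> D `|` S `<=` D `|` \bigcup_(S in F) S.
      by move=> FS C [|SC]; [left|right; exists S].
    move=> [DA|[SA FSA SAA]] [DB|[SB FSB SBB]].
    - by exists set0; rewrite setU0; split=> //; exact: subsetUl.
    - by exists SB; split; [exact: FF|exact: sub|left|right].
    - by exists SA; split; [exact: FF|exact: sub|right|left].
    - have [SAB|SBA] := UF _ _ FSA FSB.
        by exists SB; split; [exact: FF|exact: sub|right; exact: SAB|right].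
      by exists SA; split; [exact: FF|exact: sub|right|right; exact: SBA].
  split=> [A DFA|A B DFA DFB].
    by have [S [[bS _] _ SA _]] := common A A DFA DFA; exact: bS.
  have [S [[_ bS] sS SA SB]] := common A B DFA DFB.
  by have [C SC CAB] := bS A B SA SB; exists C => //; exact: sS.
exists (D `|` S); split; [exact: bS|exact: subsetUl|].
move=> M' bM' DSM' A M'A; apply: contrapT => nA.
have DM' : D `|` M' = M' by apply: setUidr => B DB; apply: DSM'; left.
apply: (maxS M'); last by rewrite DM'.
split=> [B SB|M'S]; first by apply: DSM'; right.
by apply: nA; right; exact: M'S.
Qed.

(** In a maximal base each scalar coordinate is constant on some member, and these constants make up
    [b]. The blocks [i] and [j] have finitely many coordinates, so one member inside [A] realizes
    all of them. *)
Lemma linear_compactness (D : set (set P)) : affine_base D -> D !=set0 ->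
  exists b : P, forall i j A, D A -> exists2 x, A x & x i = b i /\ x j = b j.
Proof.
move=> /affine_base_maximal[M [[Maff Mdir] DM maxM]] [D0 DD0].
have M0 := DM _ DD0.
(* A coordinate that is nonconstant on an affine set vanishes somewhere on it.  So if
   it were constant on no member of [M], its zero set could be added to [M]. *)
have const i k : exists b, exists2 A, M A & forall x, A x -> x i 0 k = b.
  apply: contrapT => ncst.
  pose E := [set x : P | x i 0 k = 0].
  have meetE A : M A -> (A `&` E) !=set0.
    move=> MA; have [affA [x Ax]] := Maff _ MA.
    have [y Ay xy] : exists2 y, A y & y i 0 k != x i 0 k.
      apply: contrapT => ny; apply: ncst; exists (x i 0 k), A => // y Ay.
      by apply/eqP; apply: contrapT => /negP yx; apply: ny; exists y.
    (* The parameter at which the line through [x] and [y] meets [E]. *)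
    exists (affine_combination (x i 0 k / (x i 0 k - y i 0 k)) x y).
    split; first exact: affA.
    rewrite /E /= /affine_combination !mxE; field.
    by rewrite subr_eq0 eq_sym.
  pose M' := M `|` [set A `&` E | A in M].
  have affE A : M A -> affine_set (A `&` E).
    move=> /Maff[affA _] x y a [Ax Ex] [Ay Ey]; split; first exact: affA.
    by rewrite /E /= /affine_combination !mxE Ex Ey !mulr0 addr0.
  have bM' : affine_base M'.
    have repr A : M' A -> exists2 B, M B & B `&` E `<=` A.
      by move=> [MA|[B MB <-]]; [exists A => // x []|exists B].
    split=> [A [MA|[B MB <-]]|A B]; first exact: Maff.
      by split; [exact: affE|exact: meetE].
    move=> /repr[A' MA' sA] /repr[B' MB' sB].
    have [C MC CAB] := Mdir _ _ MA' MB'.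
    exists (C `&` E); first by right; exists C.
    by move=> x [Cx Ex]; have [? ?] := CAB _ Cx; split; [apply: sA|apply: sB].
  apply: ncst; exists 0, (D0 `&` E); last by move=> x [].
  by apply: (maxM _ bM'); [exact: subsetUl|right; exists D0].
have /choice[b bP] : forall ik : {i : I & 'I_(n i)}, exists b,
    exists2 A, M A & forall x : P, A x -> x (projT1 ik) 0 (projT2 ik) = b.
  by move=> [i k]; exact: const.
pose bb i : 'rV[R]_(n i) := \row_k b (existT _ i k).
have constv i : exists2 A, M A & forall x, A x -> x i = bb i.
  suff /(_ (n i))[A MA Ab] : forall m, exists2 A, M A &
      forall x, A x -> forall k : 'I_(n i), (k < m)%N -> x i 0 k = bb i 0 k.
    by exists A => // x Ax; apply/rowP => k; exact: Ab.
  elim=> [|m [A MA Ab]]; first by exists D0.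
  have [mn|nm] := ltnP m (n i); last first.
    exists A => // x Ax k _; apply: Ab => //; exact: leq_trans (ltn_ord k) nm.
  have [B MB Bb] := bP (existT _ i (Ordinal mn)).
  have [C MC CAB] := Mdir _ _ MA MB.
  exists C => // x /CAB[Ax Bx] k; rewrite ltnS leq_eqVlt => /orP[/eqP km|]; last exact: Ab.
  have -> : k = Ordinal mn by exact: val_inj.
  by rewrite mxE; exact: Bb.
exists bb => i j A /DM MA.
have [B MB Bb] := constv i; have [C MC Cb] := constv j.
have [E ME EAB] := Mdir _ _ MA MB; have [G MG GEC] := Mdir _ _ ME MC.
have [_ [x Gx]] := Maff _ MG.
have [Ex Cx] := GEC _ Gx; have [Ax Bx] := EAB _ Ex.
by exists x => //; split; [exact: Bb|exact: Cb].
Qed.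

(** The families compatible below [j] form a nonempty affine set [D j] that shrinks as [j] grows. At
    any two indices [b] agrees with a member of [D j], and compatibility concerns only two indices
    at a time. *)
Lemma affine_inverse_limit (le : I -> I -> Prop) (A : forall i, set 'rV[R]_(n i))
    (p : forall i j, 'rV[R]_(n j) -> 'rV[R]_(n i)) :
  directed le ->
  (forall i, A i !=set0) ->
  (forall i a x y, A i x -> A i y -> A i ((1 - a) *: x + a *: y)) ->
  (forall i j x, le i j -> A j x -> A i (p i j x)) ->
  (forall i j a x y, le i j -> A j x -> A j y ->
     p i j ((1 - a) *: x + a *: y) = (1 - a) *: p i j x + a *: p i j y) ->
  (forall i x, A i x -> p i i x = x) ->
  (forall i j k x, le i j -> le j k -> A k x -> p i j (p j k x) = p i k x) ->
  exists b : P, (forall i, A i (b i)) /\ forall i j, le i j -> p i j (b j) = b i.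
Proof.
move=> [[i0] lexx letr ledir] A0 Aaff pA paff p1 pM.
pose D j := [set x : P | A j (x j) /\ forall i, le i j -> x i = p i j (x j)].
have DS j k : le j k -> D k `<=` D j.
  move=> jk x [Ax xE]; split; first by rewrite (xE _ jk); exact: pA.
  by move=> i ij; rewrite (xE _ jk) pM//; apply: xE; exact: letr jk.
have bD : affine_base [set D j | j in setT].
  split=> [_ [j _ <-]|_ _ [j _ <-] [k _ <-]]; last first.
    have [l [jl kl]] := ledir j k.
    by exists (D l); [exists l|move=> x Dx; split; exact: DS Dx].
  split=> [x y a [Ax xE] [Ay yE]|].
    split=> [|i ij]; first exact: Aaff.
    by rewrite /affine_combination paff// -xE// -yE.
  have [a Aa] := A0 j.
  (* [D j] restricts only the coordinates at indices below [j]; the others may be 0. *)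
  exists (fun i => if pselect (le i j) then p i j a else 0) => /=.
  rewrite /D /=; case: pselect => // jj; rewrite p1//; split=> // i ij.
  by case: pselect.
have [|b bP] := linear_compactness bD; first by exists (D i0), i0.
exists b; split=> [i|i j ij].
  by have [|x [Ax _] [<- _]] := bP i i (D i); first by exists i.
have [|x [_ xE] [<- <-]] := bP i j (D j); first by exists j.
by rewrite -xE.
Qed.

End LinearCompactness.

(** * Quotients of topological groups *)

Section Quotients.
Variables (G : topologicalGroupType) (N : normal_subgroup G).
Local Open Scope group_scope.

Lemma qproj_mul x y : qproj N (x * y) = qproj N x * qproj N y.
Proof. by rewrite [RHS]qmul_proj. Qed.

Lemma quotient_group_hausdorff : closed (nsub_set N) -> hausdorff_space (quotient_group N).
Proof.
move=> clN p q; rewrite -(qproj_repr p) -(qproj_repr q).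
set x := repr p; set y := repr q => clpq.
apply/qproj_eq; apply: contrapT => nxy.
have nC : nbhs (x^-1 * y) (~` nsub_set N).
  by apply: open_nbhs_nbhs; split=> //; exact: closed_openC.
have cxy : (fun ab : G * G => ab.1^-1 * ab.2) @ (x, y) --> x^-1 * y.
  by apply: cvg_mulg; [apply: cvg_invg; exact: cvg_fst|exact: cvg_snd].
have [[A B] /= [nA nB] AB] := cxy _ nC.
have [z [[a Aa az] [b Bb bz]]] := clpq _ _ (qproj_nbhs N nA) (qproj_nbhs N nB).
apply: (AB (a, b)) => //=; apply/qproj_eq; by rewrite az bz.
Qed.

Variables (K : topologicalGroupType) (phi : G -> K).
Hypothesis phiM : {morph phi : x y / x * y}.
Hypothesis phiC : continuous phi.
Hypothesis phiN : forall x, nsub_set N x -> phi x = 1.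

(** The induced map on the quotient, evaluated at a chosen representative; [quotient_liftE] shows
    independence of the choice when [phi] is trivial on [N]. *)
Definition quotient_lift (a : quotient_group N) : K := phi (repr a).

Lemma quotient_liftE x : quotient_lift (qproj N x) = phi x.
Proof.
have /qproj_eq/phiN : qproj N (repr (qproj N x)) = qproj N x by exact: qproj_repr.
by rewrite phiM (morph_gV phiM) => /mulg1_eq; rewrite invgK.
Qed.

Lemma quotient_liftM : {morph quotient_lift : a b / a * b}.
Proof.
move=> a b; rewrite -(qproj_repr a) -(qproj_repr b) -qproj_mul.
by rewrite !quotient_liftE phiM.
Qed.

Lemma quotient_lift_continuous : continuous quotient_lift.
Proof.
move=> a; rewrite -(qproj_repr a) => W; rewrite quotient_liftE => nW.
have nU : nbhs (repr a) (phi @^-1` W) by exact: phiC.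
by apply: filterS (qproj_nbhs N nU) => _ [u Wu <-]; rewrite /= quotient_liftE.
Qed.

Lemma quotient_lift_morphism : (forall A : set G, open A -> open (phi @` A)) ->
  (forall y, exists x, phi x = y) -> quotient_morphism quotient_lift.
Proof.
move=> phiO phiS; split.
- exact: quotient_liftM.
- exact: quotient_lift_continuous.
- move=> A oA.
  have -> : quotient_lift @` A = phi @` (qproj N @^-1` A).
    apply/seteqP; split=> [_ [a Aa <-]|_ [x Ax <-]].
      by exists (repr a) => //; rewrite /= qproj_repr.
    by exists (qproj N x) => //; exact: quotient_liftE.
  by apply: phiO; apply: open_comp => // x _; exact: qproj_continuous.
- by move=> y; have [x <-] := phiS y; exists (qproj N x); exact: quotient_liftE.
Qed.

End Quotients.

Section ClosureOfImage.
Variables (G H : topologicalGroupType) (f : G -> H).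
Hypothesis hf : quotient_morphism f.
Variable N : normal_subgroup G.
Local Open Scope group_scope.

Let S := closure (f @` nsub_set N).

Let fM : {morph f : x y / x * y}. Proof. by case: hf. Qed.

Fact closure_image1 : S 1.
Proof.
apply: subset_closure; exists 1; [exact: nsub1|exact: morph_g1].
Qed.

Fact closure_imageM x y : S x -> S y -> S (x * y).
Proof.
move=> Sx Sy W nW.
have [[A B] /= [nA nB] AB] := @topmul_continuous H (x, y) _ nW.
have [_ [[u Nu <-] Au]] := Sx _ nA; have [_ [[v Nv <-] Bv]] := Sy _ nB.
exists (f u * f v); split; last exact: (AB (f u, f v)).
by exists (u * v); [exact: nsubM|exact: fM].
Qed.

Fact closure_imageV x : S x -> S x^-1.
Proof.
move=> Sx W nW; have nA := @topinv_continuous H x _ nW.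
have [_ [[u Nu <-] Au]] := Sx _ nA.
exists (f u)^-1; split=> //.
by exists u^-1; [exact: nsubV|exact: morph_gV].
Qed.

Fact closure_imageJ x y : S x -> S (x ^ y).
Proof.
move=> Sx W nW.
have cy : (fun z : H => z ^ y) @ x --> x ^ y.
  by apply: cvg_mulg; [exact: cvg_cst|apply: cvg_mulg; [exact: cvg_id|exact: cvg_cst]].
have [_ [[u Nu <-] Wu]] := Sx _ (cy _ nW).
exists (f u ^ y); split=> //.
have [v fv] : exists v, f v = y by case: hf.
exists (u ^ v); first exact: nsubJ.
by rewrite !conjgE !fM (morph_gV fM) fv.
Qed.

(** The image of [N] under [f] need not be closed; its closure gives a Hausdorff quotient of [H], in
    which limits are unique. *)
Definition closure_image : normal_subgroup H :=
  NormalSubgroup closure_image1 closure_imageM closure_imageV closure_imageJ.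

End ClosureOfImage.

Section Combination.
Variables (R : realType) (L K : topologicalGroupType) (h : L -> K).
Hypothesis hM : {morph h : x y / (x * y)%g}.
Hypothesis hC : continuous h.

Lemma cvg_morph_power (F : set_system nat) (u : nat -> L) (z : nat -> int) (y : L) :
  (fun i => expgz (u i) (z i)) @ F --> y ->
  (fun i => expgz (h (u i)) (z i)) @ F --> h y.
Proof.
move=> uy.
have -> : (fun i => expgz (h (u i)) (z i)) = (fun i => h (expgz (u i) (z i))).
  by apply/funext => i; rewrite (morph_gz hM).
exact: (@cvg_comp _ _ _ (fun i => expgz (u i) (z i)) h F (nbhs y) _ uy (@hC y)).
Qed.

End Combination.

(** * Gluing *)

Section CombinationMorphism.
Variables (R : realType) (L K : topologicalGroupType) (n : nat).
Variable c : local_chart R L n.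
Hypothesis hausL : hausdorff_space L.
Variable h : L -> K.
Hypotheses (hM : {morph h : x y / (x * y)%g}) (hC : continuous h).
Local Notation lam := (@natS R).

(** By [tangent_inj], [Z] is the limit in the product formula for [X] and [Y], and [h] commutes with
    that limit. *)
Lemma tangent_combination_morph (F : set_system nat) (X Y Z : R -> L) w w' a b :
  UltraFilter F -> \oo `<=` F ->
  one_parameter_subgroup X -> one_parameter_subgroup Y ->
  one_parameter_subgroup Z -> tangent c X w -> tangent c Y w' ->
  tangent c Z (a *: w + b *: w') ->
  forall t, (fun i => expgz (h (X (a / lam i)%R) * h (Y (b / lam i)%R))%g
                 (Num.floor (t * lam i))) @ F --> h (Z t).
Proof.
move=> UF sF XP YP ZP Xw Yw Zw t.
have [Z' [Z'P Z'w Z'lim]] := tangent_combination hausL a b UF sF XP YP Xw Yw.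
have ZZ' := tangent_inj ZP Z'P Zw Z'w.
have := cvg_morph_power hM hC (Z'lim t); rewrite -ZZ'.
by under [in X in X -> _]eq_fun do rewrite hM.
Qed.

Hypothesis hausK : hausdorff_space K.

(** As the weights [1 - a] and [a] add up to 1, the factors in the product formula for [h \o Z]
    multiply to [X (1 / lam i)], whose powers tend to [X]. *)
Lemma lifts_affine (X : R -> K) (Y Y' Z : R -> L) w w' a :
  one_parameter_subgroup X ->
  one_parameter_subgroup Y -> one_parameter_subgroup Y' ->
  one_parameter_subgroup Z -> tangent c Y w -> tangent c Y' w' ->
  tangent c Z ((1 - a) *: w + a *: w') ->
  X = h \o Y -> X = h \o Y' -> X = h \o Z.
Proof.
move=> XP YP Y'P ZP Yw Y'w' Zw XY XY'.
have [F UF sF] := exists_ultrafilter_infty.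
have lamF : lam @ F --> +oo by exact: cvg_natS.
apply/funext => t /=.
have h1 := tangent_combination_morph UF sF YP Y'P ZP Yw Y'w' Zw (t := t).
have h2 : (fun i => expgz (X (lam i)^-1) (Num.floor (t * lam i))) @ F --> X t.
  exact: cvg_oneparam_floor.
apply: (cvg_unique hausK h2).
suff -> : (fun i => expgz (X (lam i)^-1) (Num.floor (t * lam i))) =
  (fun i => expgz (h (Y ((1 - a) / lam i)%R) * h (Y' (a / lam i)%R))%g
                 (Num.floor (t * lam i))) by exact: h1.
apply/funext => i; congr expgz.
rewrite -[h (Y _)]/((h \o Y) _) -[h (Y' _)]/((h \o Y') _) -XY -XY' -(oneparamD XP).
by rewrite -mulrDl subrK mul1r.
Qed.

End CombinationMorphism.

(** The differential of [h] is linear: the product formula describes both [h \o Z] and the subgroup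
    of [K] with tangent vector [a *: v + b *: v']. *)
Lemma tangent_morph_affine (R : realType) (L K : topologicalGroupType) n m
    (c : local_chart R L n) (d : local_chart R K m) (h : L -> K)
    (X Y Z : R -> L) w w' v v' a b :
  hausdorff_space L -> hausdorff_space K ->
  {morph h : x y / (x * y)%g} -> continuous h ->
  one_parameter_subgroup X -> one_parameter_subgroup Y ->
  one_parameter_subgroup Z ->
  tangent c X w -> tangent c Y w' -> tangent c Z (a *: w + b *: w') ->
  tangent d (h \o X) v -> tangent d (h \o Y) v' ->
  tangent d (h \o Z) (a *: v + b *: v').
Proof.
move=> hausL hausK hM hC XP YP ZP Xw Yw Zw Xv Yv.
have [F UF sF] := exists_ultrafilter_infty.
have XP' := oneparam_comp hC hM XP; have YP' := oneparam_comp hC hM YP.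
have [Z' [Z'P Z'w Z'lim]] := tangent_combination hausK a b UF sF XP' YP' Xv Yv.
suff -> : h \o Z = Z' by [].
apply/funext => t; apply: (cvg_unique hausK _ (Z'lim t)).
exact: (tangent_combination_morph hausL hM hC UF sF XP YP ZP Xw Yw Zw).
Qed.

(** * The inverse system of Lie quotients of a pro-Lie group *)

Section ProLieGroups.
Variables (R : realType) (G H : topologicalGroupType) (f : G -> H).
Hypotheses (hG : pro_lie R G) (hausH : hausdorff_space H) (hf : quotient_morphism f).
Variable X : R -> H.
Hypothesis XP : one_parameter_subgroup X.

Let I := {N : normal_subgroup G | lie_quotient_subgroups R N}.
Let N (i : I) : normal_subgroup G := sval i.
Let L i : topologicalGroupType := quotient_group (N i).
(** Reverse inclusion: going up means passing to smaller subgroups and finer quotients. *)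
Let le (i j : I) := nsub_set (N j) `<=` nsub_set (N i).

Let hausL i : hausdorff_space (L i).
Proof. by case: (svalP i) => _ []. Qed.

Let hausG : hausdorff_space G. Proof. by case: hG. Qed.

Let small U : nbhs (1%g : G) U -> exists i, nsub_set (N i) `<=` U.
Proof.
by move=> nU; case: hG => _ _ _ /(_ _ nU)[M lM MU]; exists (exist _ M lM).
Qed.

Let directed_le : directed le.
Proof.
split=> [||i j k ij jk x /jk/ij|[M lM] [M' lM']]; [|by move=> i x|by []|].
  by have [|i _] := @small setT; [exact: filterT|exact: inhabits i].
case: hG => _ _ /(_ _ _ lM lM')[M'' lM'' MM] _.
by exists (exist _ M'' lM''); split=> x /MM[].
Qed.

Let chart_ex i : exists n, inhabited (local_chart R (L i) n).
Proof. by apply: lie_group_local_chart; exact: (svalP i).2. Qed.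

Let n i := sval (cid (chart_ex i)).

Let c i : local_chart R (L i) (n i).
Proof. by have /inhabited_witness := svalP (cid (chart_ex i)). Qed.

Let C i := closure_image hf (N i).
Let Q i : topologicalGroupType := quotient_group (C i).

Let fM : {morph f : x y / (x * y)%g}. Proof. by case: hf. Qed.

Let hausQ i : hausdorff_space (Q i).
Proof. by apply: quotient_group_hausdorff; exact: closed_closure. Qed.

Let q i : G -> Q i := qproj (C i) \o f.

Let qM i : {morph q i : x y / (x * y)%g}.
Proof. by move=> x y; rewrite /q /= fM qproj_mul. Qed.

Let qC i : continuous (q i).
Proof.
move=> x; apply: (@continuous_comp _ _ _ f (qproj (C i))); last exact: qproj_continuous.
by case: hf => _ + _ _; apply.
Qed.

Let qproj1 (K : topologicalGroupType) (M : normal_subgroup K) x :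
  nsub_set M x -> qproj M x = 1%g.
Proof.
move=> Mx; apply/qproj_eq; rewrite mulg1; exact: nsubV.
Qed.

Let qN i x : nsub_set (N i) x -> q i x = 1%g.
Proof.
by move=> Nx; apply: qproj1; apply: subset_closure; exists x.
Qed.

Let h i : L i -> Q i := quotient_lift (q i).

Let h_morph i : quotient_morphism (@h i).
Proof.
apply: quotient_lift_morphism; [exact: qM|exact: qC|exact: qN| |].
- move=> A oA; have -> : q i @` A = qproj (C i) @` (f @` A) by rewrite image_comp.
  apply: qproj_open; by case: hf => _ _ + _; apply.
- move=> y; have [z <-] : exists z, qproj (C i) z = y by exists (repr y); exact: qproj_repr.
  by case: hf => _ _ _ /(_ z)[x <-]; exists x.
Qed.

Let tr i j : L j -> L i := quotient_lift (qproj (N i)).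

Let trN i j : le i j -> forall x, nsub_set (N j) x -> qproj (N i) x = 1%g.
Proof. by move=> ij x /ij; exact: qproj1. Qed.

Let trE i j : le i j -> forall x, @tr i j (qproj (N j) x) = qproj (N i) x.
Proof.
by move=> ij x; apply: quotient_liftE; [exact: qproj_mul|exact: trN].
Qed.

Let trM i j : le i j -> {morph @tr i j : x y / (x * y)%g}.
Proof. by move=> ij; apply: quotient_liftM; [exact: qproj_mul|exact: trN]. Qed.

Let trC i j : le i j -> continuous (@tr i j).
Proof.
by move=> ij; apply: quotient_lift_continuous;
  [exact: qproj_mul|exact: qproj_continuous|exact: trN].
Qed.

(** [Exp] is the exponential map in coordinates, with [Exp w] the whole one-parameter subgroup;
    [Log] is its inverse. *)
Let Exp i (w : 'rV[R]_(n i)) : R -> L i := sval (cid2 (tangent_surj (c i) (@hausL i) w)).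

Let ExpP i w : one_parameter_subgroup (@Exp i w).
Proof. by rewrite /Exp; case: cid2. Qed.

Let Exp_tangent i w : tangent (c i) (@Exp i w) w.
Proof. by rewrite /Exp; case: cid2. Qed.

Let Log i (Y : R -> L i) : 'rV[R]_(n i) := xget 0 [set w | tangent (c i) Y w].

Let Log_tangent i (Y : R -> L i) : one_parameter_subgroup Y -> tangent (c i) Y (Log Y).
Proof.
move=> YP; have [w Yw] := tangent_exists (c i) (@hausL i) YP.
exact: (@xgetPex _ 0 [set w | tangent (c i) Y w]) (ex_intro _ w Yw).
Qed.

Let ExpLog i (Y : R -> L i) : one_parameter_subgroup Y -> Exp (Log Y) = Y.
Proof.
move=> YP; exact: tangent_inj (ExpP _) YP (Exp_tangent _) (Log_tangent YP).
Qed.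

Let LogExp i w : Log (@Exp i w) = w.
Proof. exact: tangent_unique (Log_tangent (ExpP w)) (Exp_tangent w). Qed.

(** The tangent vectors of the lifts to [L i] of [X] modulo [C i]. *)
Let A i := [set w : 'rV[R]_(n i) | qproj (C i) \o X = @h i \o Exp w].
(** The differential of [tr i j] in coordinates, for [le i j]. *)
Let p i j (w : 'rV[R]_(n j)) : 'rV[R]_(n i) := Log (@tr i j \o Exp w).

Let qXP i : one_parameter_subgroup (qproj (C i) \o X : R -> Q i).
Proof. by apply: oneparam_comp => //; [exact: qproj_continuous|exact: qproj_mul]. Qed.

Let trExpP i j w : le i j -> one_parameter_subgroup (@tr i j \o Exp w).
Proof. by move=> ij; apply: oneparam_comp; [exact: trC|exact: trM|exact: ExpP]. Qed.

Let le_C i j : le i j -> nsub_set (C j) `<=` nsub_set (C i).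
Proof. by move=> ij; apply: closure_subset; exact: image_subset. Qed.

Let hE i x : @h i (qproj (N i) x) = qproj (C i) (f x).
Proof. by apply: quotient_liftE; [exact: qM|exact: qN]. Qed.

(** Linear compactness for the sets [A i] and the maps [p i j]: the sets are nonempty by
    [oneparam_lift_lie] and affine by [lifts_affine], and the maps are affine by
    [tangent_morph_affine]. *)
Lemma compatible_lifts : exists Y : forall i, R -> L i,
  [/\ forall i, one_parameter_subgroup (Y i),
      forall i, qproj (C i) \o X = @h i \o Y i
    & forall i j, le i j -> @tr i j \o Y j = Y i].
Proof.
have [||||||b [Ab pb]] := @affine_inverse_limit R I n le A p directed_le.
- move=> i; have [Y YP XY] := oneparam_lift_lie (c i) (@hausL i) (@hausQ i) (h_morph i) (qXP i).
  by exists (Log Y); rewrite /A /= ExpLog.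
- move=> i a x y Ax Ay.
  have [hiM hiC _ _] := h_morph i.
  exact: (lifts_affine (@hausL i) hiM hiC (@hausQ i) (qXP i) (ExpP x) (ExpP y) (ExpP _)
    (Exp_tangent x) (Exp_tangent y) (Exp_tangent _) Ax Ay).
- move=> i j x ij Ax; rewrite /A /= /p ExpLog; last exact: trExpP.
  apply/funext => t /=; have /(congr1 (fun u => u t)) /= := Ax.
  rewrite -(qproj_repr (Exp x t)) trE// !hE => /qproj_eq Cx.
  by apply/qproj_eq; exact: le_C Cx.
- move=> i j a x y ij Ax Ay.
  have trP z := trExpP z ij.
  apply: tangent_unique (Log_tangent (trP _)) _.
  apply: (tangent_morph_affine (@hausL j) (@hausL i) (trM ij) (trC ij)
    (ExpP x) (ExpP y) (ExpP _) (Exp_tangent x) (Exp_tangent y) (Exp_tangent _));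
  exact: Log_tangent.
- move=> i x _; rewrite /p -[RHS]LogExp; congr (Log _); apply/funext => t /=.
  by rewrite -[in LHS](qproj_repr (Exp x t)) trE ?qproj_repr// => z.
- move=> i j k x ij jk _; rewrite /p ExpLog; last exact: trExpP.
  congr (Log _); apply/funext => t /=; rewrite -(qproj_repr (Exp x t)) !trE//.
  by move=> z /jk/ij.
exists (fun i => Exp (b i)); split=> // i j ij.
by rewrite -[in RHS](pb _ _ ij) /p ExpLog//; exact: trExpP.
Qed.

Let eq_of_qproj x y : (forall i, qproj (N i) x = qproj (N i) y) -> x = y.
Proof.
move=> xy; have xyN i : nsub_set (N i) (x^-1 * y)%g by apply/qproj_eq; exact: xy.
suff xy1 : (1%g : G) = (x^-1 * y)%g by rewrite -[y](mulVKg x) -xy1 mulg1.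
apply: hausG => U V nU nV; have [i NU] := small nU.
by exists (x^-1 * y)%g; split; [exact: NU|exact: nbhs_singleton].
Qed.

(** Representatives of [y j] and [y k] with [j] and [k] above [i] differ by an element of [N i], so
    they form a left Cauchy net, which converges by completeness. Its image in [L i] is eventually
    constant with value [y i]. *)
Lemma glue_points (y : forall i, L i) : (forall i j, le i j -> @tr i j (y j) = y i) ->
  exists x : G, forall i, qproj (N i) x = y i.
Proof.
move=> try_; have [_ _ _ ledir] := directed_le.
have yE i j : le i j -> qproj (N i) (repr (y j)) = y i.
  by move=> ij; rewrite -(trE ij) qproj_repr try_.
have [x xlim] : exists x, net_converges le (fun i => repr (y i)) x.
  case: hG => _ compG _ _; apply: (compG) => // E [U nU UE].
  have [i NU] := small nU; exists i => j k ij ik; apply: UE => /=; apply: NU.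
  by apply/qproj_eq; rewrite !yE.
exists x => i; apply: (@hausL i) => U V nU nV.
have [j jU] := xlim _ (@qproj_continuous _ (N i) x _ nU).
have [k [ik jk]] := ledir i j.
exists (y i); split; last exact: nbhs_singleton.
by rewrite -(yE _ _ ik); exact: jU.
Qed.

Lemma oneparam_lift_pro_lie : exists2 Y : R -> G, one_parameter_subgroup Y & X = f \o Y.
Proof.
have [Yi [YiP XYi trY]] := compatible_lifts.
have /choice[Y YE] : forall t, exists x, forall i, qproj (N i) x = Yi i t.
  move=> t; apply: glue_points => i j ij.
  by have /(congr1 (fun u => u t)) := trY i j ij.
have YM s t : Y (s + t) = (Y s * Y t)%g.
  by apply: eq_of_qproj => i; rewrite qproj_mul !YE (oneparamD (YiP i)).
exists Y.
  apply: oneparam_of_cvg1 => // U nU.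
  have nU' : nbhs (1 * 1 : G)%g U by rewrite mulg1.
  have [[V W] /= [nV nW] VW] := @topmul_continuous G (1, 1)%g _ nU'.
  (* Modulo [N i] the point [Y t] comes from [V], so it lies in [V * N i], inside [V * W] and thus
     in [U]. *)
  have [i NW] := small nW.
  have Y1 : \forall t \near (0 : R), (qproj (N i) @` V) (Yi i t).
    by apply: (oneparam_cvg1 (YiP i)); exact: (qproj_nbhs (N i) nV).
  suff : \forall t \near (0 : R), U (Y t) by [].
  apply: filterS Y1 => t [v Vv]; rewrite -YE => /qproj_eq/NW Wv.
  rewrite -[Y t](mulVKg v); exact: (VW (v, v^-1 * Y t)%g).
apply/funext => t /=.
have XC i : nsub_set (C i) ((f (Y t))^-1 * X t)%g.
  apply/qproj_eq; have /(congr1 (fun u => u t)) /= := XYi i.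
  by rewrite -YE hE.
(* Each neighbourhood of 1 contains the image of some [N i], and each neighbourhood of
   [(f (Y t))^-1 * X t] meets this image, as the point lies in its closure [C i]. Since [H] is
   Hausdorff, the point is 1. *)
suff z1 : (1%g : H) = ((f (Y t))^-1 * X t)%g by rewrite -[LHS](mulVKg (f (Y t))) -z1 mulg1.
apply: hausH => U V nU nV.
have nfU : nbhs (1%g : G) (f @^-1` U).
  by case: hf => _ fC _ _; apply: fC; rewrite (morph_g1 fM).
have [i NU] := small nfU.
have [y [[x Nx <-] Vy]] := XC i _ nV.
by exists (f x); split=> //; exact: NU.
Qed.

End ProLieGroups.

Theorem theorem2 (R : realType) (G H : topologicalGroupType) (f : G -> H)
    (hG : pro_lie R G) (hH : pro_lie R H) (hf : quotient_morphism f)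
    (X : R -> H) (hX : one_parameter_subgroup X) :
  exists2 Y : R -> G, one_parameter_subgroup Y & X = f \o Y.
Proof. by case: hH => hausH _ _ _; exact: oneparam_lift_pro_lie. Qed.
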